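(* Let $P$ be a connected finite $T_0$ space (equivalently, a connected finite poset), and let $\mathcal{K}(P)$ be its order complex. Then for every integer $n\ge 2$, $$\mathsf{CC}^{\Sigma}_n(P)=\mathsf{SC}^{\Sigma}_n(\mathcal{K}(P))=\mathsf{TC}^{\Sigma}_n(|\mathcal{K}(P)|),$$ where $\mathsf{CC}^{\Sigma}_n$, $\mathsf{SC}^{\Sigma}_n$, $\mathsf{TC}^{\Sigma}_n$ denote the $n$-th symmetric combinatorial, simplicial and topological complexity respectively.
   Context: Finite spaces. A finite poset $P$ is regarded as a finite $T_0$ space whose open sets are the down-sets (basic open sets $U_x=\{y: y\le x\}$); continuous maps are exactly order preserving maps. For finite posets, $Q^P$ is the poset of order preserving maps $P\to Q$ with pointwise order. $\mathcal{K}(P)$ is the order complex (vertices are the elements of $P$, simplices are finite nonempty chains), $\mathcal{X}(K)$ is the face poset of a simplicial complex $K$ ordered by inclusion; $\mathrm{sd}(P)=\mathcal{X}(\mathcal{K}(P))$ and $\mathrm{sd}^r$ is its $r$-fold iterate. $\tau_P:\mathrm{sd}(P)\to P$ sends a chain to its largest element, and $\tau^r_{P^n}:\mathrm{sd}^r(P^n)\to P^n$ is the composite $\tau_{P^n}\circ\tau_{\mathrm{sd}(P^n)}\circ\cdots\circ\tau_{\mathrm{sd}^{r-1}(P^n)}$ (identity if $r=0$). Symmetric combinatorial complexity. $\Sigma_n$ is the symmetric group on $\{1,\dots,n\}$. $J_{n,m}$ is the poset with $nm+1$ elements $0$ and $t_j$ ($1\le t\le m$, $1\le j\le n$), whose order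 is generated by the $n$ fences $0\le 1_j\ge 2_j\le\cdots\ge(\le)\, m_j$ (we put $0_j=0$). Let $q_{n,m}:P^{J_{n,m}}\to P^n$, $q_{n,m}(\gamma)=(\gamma(m_1),\dots,\gamma(m_n))$. Each $g\in\Sigma_n$ acts on $P^n$ by $g(x_1,\dots,x_n)=(x_{g(1)},\dots,x_{g(n)})$, on $\mathrm{sd}^r(P^n)$ by the induced action, and on $P^{J_{n,m}}$ by $(g\gamma)(t_j)=\gamma(t_{g(j)})$. $\mathsf{CC}^{\Sigma,r}_{n,m}(P)$ is the minimum $k$ such that $\mathrm{sd}^r(P^n)$ has a cover by $k$ $\Sigma_n$-invariant open sets $Q_1,\dots,Q_k$ with $\Sigma_n$-equivariant continuous maps $s_i:Q_i\to P^{J_{n,m}}$ satisfying $q_{n,m}\circ s_i=\tau^r_{P^n}|_{Q_i}$ ($\infty$ if none). It is non-increasing in $m$; $\mathsf{CC}^{\Sigma,r}_n(P)$ denotes its stable value for large $m$, and $\mathsf{CC}^{\Sigma}_n(P)=\min_{r\ge0}\mathsf{CC}^{\Sigma,r}_n(P)$. Symmetric topological complexity. $I_n$ is the wedge of $n$ copies $[0,1]_j$ of $[0,1]$ glued at $0$; $t_j$ is the point $t$ of the $j$-th copy. For a space $X$, $e_n:X^{I_n}\to X^n$ is $e_n(\alpha)=(\alpha(1_1),\dots,\alpha(1_n))$; each $g\in\Sigma_n$ acts on $X^n$ by $g(x_1,\dots,x_n)=(x_{g(1)},\dots,x_{g(n)})$ and on $X^{I_n}$ by $(g\alpha)(t_j)=\alpha(t_{g(j)})$.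 $\mathsf{TC}^{\Sigma}_n(X)$ is the least $k$ such that $X^n$ is covered by $k$ $\Sigma_n$-invariant open sets each admitting a continuous $\Sigma_n$-equivariant section of $e_n$ ($\infty$ if none). Symmetric simplicial complexity. For an ordered simplicial complex $K$ (a partial order on vertices, total on each simplex; for $K=\mathcal{K}(P)$ use the order of $P$), $K^n$ has vertex set $V(K)^n$ with the componentwise order, a finite chain of vertices being a simplex iff all its coordinate projections are simplices of $K$; each $g\in\Sigma_n$ acts on vertices by $g(v_1,\dots,v_n)=(v_{g(1)},\dots,v_{g(n)})$, and this induces an action on the iterated barycentric subdivisions $\mathrm{sd}^r(K^n)$. A $\Sigma_n$-approximation of the identity is a $\Sigma_n$-equivariant simplicial map $\mathrm{sd}(M)\to M$ that is a simplicial approximation of $\mathrm{Id}_{|M|}$. Choosing such maps $\mathrm{sd}^{i+1}(K^n)\to\mathrm{sd}^i(K^n)$, let $\iota^r_{K^n}:\mathrm{sd}^r(K^n)\to K^n$ be the composite and $\pi_j=p_j\circ\iota^r_{K^n}$, $p_j:K^n\to K$ the $j$-th projection. Simplicial maps $\phi_1,\dots,\phi_n:M\to N$ with $\phi_j(gv)=\phi_{g(j)}(v)$ (with $\Sigma_n$ acting simplicially on $M$) are symmetrically contiguous if there are a simplicial map $\phi_*:M\to N$ with $\phi_*(gv)=\phi_*(v)$, an integer $c\ge1$, and simplicial maps $\phi_*=\phi_j^0,\dots,\phi_j^c=\phi_j$ such that $\phi_j^{l-1}(\sigma)\cup\phi_j^l(\sigma)$ is a simplex of $N$ for each simplex $\sigma$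 of $M$ and $1\le l\le c$, and $\phi^l_j(gv)=\phi^l_{g(j)}(v)$ for all $v,g,j,l$. $\mathsf{SC}^{\Sigma,r}_n(K)$ is the smallest $k$ such that $\mathrm{sd}^r(K^n)$ is covered by $k$ subcomplexes $L_i$ with $gL_i=L_i$ for all $g\in\Sigma_n$, such that $\pi_1|_{L_i},\dots,\pi_n|_{L_i}:L_i\to K$ are symmetrically contiguous for each $i$ ($\infty$ if none); it is independent of the choice of approximations. $\mathsf{SC}^{\Sigma}_n(K)=\min_{r\ge0}\mathsf{SC}^{\Sigma,r}_n(K)$. *)

(* Defs.v *)
From HB Require Import structures.
From mathcomp Require Import all_boot all_order all_algebra all_fingroup.
From mathcomp Require Import all_classical all_reals topology wedge_sigT.
From mathcomp Require Import normedtype.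

Set Implicit Arguments.
Unset Strict Implicit.
Unset Printing Implicit Defensive.

Import Order.TTheory GRing.Theory Num.Theory.
Import numFieldNormedType.Exports.

Local Open Scope classical_set_scope.
Local Open Scope ring_scope.

(** * Complexities: elements of [option nat], where [None] stands for infinity *)

Definition least (A : set nat) : option nat :=
  if pselect (exists k, `[< A k >]) is left e then Some (ex_minn e) else None.

Definition min_value (f : nat -> option nat) : option nat :=
  least [set k | exists r, f r = Some k].

(* [None] is also returned when [u] is not eventually constant; this does not
   occur for non-increasing sequences. *)
Definition stable_value (u : nat -> option nat) : option nat :=
  xget None [set v | \forall m \near \oo, u m = v].

(** * Finite posets as finite spaces *)

Definition downset_space (d : Order.disp_t) (T : porderType d) : Type := T.

Section DownsetSpace.
Context (d : Order.disp_t) (T : porderType d).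

HB.instance Definition _ := Choice.copy (downset_space T) T.

Definition downset (A : set (downset_space T)) : Prop :=
  forall x y : T, (y <= x)%O -> A x -> A y.

Fact downsetT : downset setT. Proof. by []. Qed.

Fact downsetI : setI_closed downset.
Proof.
by move=> A B dA dB x y yx [Ax Bx]; split; [exact: dA Ax|exact: dB Bx].
Qed.

Fact downset_bigcup (I : Type) (f : I -> set (downset_space T)) :
  (forall i, downset (f i)) -> downset (\bigcup_i f i).
Proof. by move=> df x y yx [i _ fx]; exists i => //; exact: df fx. Qed.

HB.instance Definition _ := isOpenTopological.Build (downset_space T)
  downsetT downsetI downset_bigcup.
End DownsetSpace.

(** * Finite ordered simplicial complexes *)

Definition simplicial (V W : finType) (S : {set {set V}}) (T : {set {set W}})
  (f : V -> W) : Prop := forall s, s \in S -> f @: s \in T.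

Record ocomplex (d : Order.disp_t) := OComplex {
  vset :> finPOrderType d;
  simp : {set {set vset}};
  simp1 : forall v, [set v]%SET \in simp;
  simp_neq0 : forall s, s \in simp -> s != finset.set0;
  simpS : forall s t : {set vset},
    s \in simp -> t \subset s -> t != finset.set0 -> t \in simp;
  simp_total : forall s, s \in simp -> {in s &, forall x y, (x >=< y)%O} }.

Record smap (d d' : Order.disp_t) (M : ocomplex d) (N : ocomplex d') := SMap {
  sfun :> M -> N;
  sfunP : simplicial (simp M) (simp N) sfun }.

Definition subcomplex (d : Order.disp_t) (M : ocomplex d)
    (L : {set {set M}}) : Prop :=
  L \subset simp M /\ forall s t : {set M},
    s \in L -> t \subset s -> t != finset.set0 -> t \in L.

(** ** Order complex *)

Section OrderComplex.
Context (d : Order.disp_t) (P : finPOrderType d).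

Definition chains : {set {set P}} :=
  [set s : {set P} |
    (s != finset.set0) && [forall x in s, forall y in s, (x >=< y)%O]]%SET.

Lemma chainsP (s : {set P}) :
  reflect (s != finset.set0 /\ {in s &, forall x y, (x >=< y)%O})
          (s \in chains).
Proof.
rewrite inE; apply: (iffP andP) => -[s0 sc]; split=> //.
  by move=> x y xs ys; exact: (forall_inP (forall_inP sc x xs)).
by apply/forall_inP => x xs; apply/forall_inP => y ys; exact: sc.
Qed.

Fact chains1 (v : P) : [set v]%SET \in chains.
Proof.
apply/chainsP; split; first by apply/set0Pn; exists v; rewrite inE.
by move=> x y /set1P-> /set1P->; exact: comparablexx.
Qed.

Fact chains_neq0 (s : {set P}) : s \in chains -> s != finset.set0.
Proof. by case/chainsP. Qed.

Fact chainsS (s t : {set P}) :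
  s \in chains -> t \subset s -> t != finset.set0 -> t \in chains.
Proof.
move=> /chainsP[_ sc] /fintype.subsetP ts t0; apply/chainsP; split=> // x y xt yt.
by apply: sc; exact: ts.
Qed.

Fact chains_total (s : {set P}) :
  s \in chains -> {in s &, forall x y, (x >=< y)%O}.
Proof. by case/chainsP. Qed.

Definition order_complex : ocomplex d :=
  OComplex chains1 chains_neq0 chainsS chains_total.
End OrderComplex.

Fact order_complex_map_simplicial (d d' : Order.disp_t) (P : finPOrderType d)
    (Q : finPOrderType d') (h : {omorphism P -> Q}) :
  simplicial (simp (order_complex P)) (simp (order_complex Q)) h.
Proof.
move=> s /chainsP[/set0Pn[x xs] sc]; apply/chainsP; split.
  by apply/set0Pn; exists (h x); exact: imset_f.
move=> _ _ /imsetP[y ys ->] /imsetP[z zs ->].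
by case/orP: (sc _ _ ys zs) => /omorph_le le_h; apply/orP; [left|right].
Qed.

Definition order_complex_map (d d' : Order.disp_t) (P : finPOrderType d)
    (Q : finPOrderType d') (h : {omorphism P -> Q}) :
    smap (order_complex P) (order_complex Q) :=
  SMap (@order_complex_map_simplicial d d' P Q h).

(** ** Face poset *)

Definition face (d : Order.disp_t) (M : ocomplex d) : Type :=
  {s : {set M} | s \in simp M}.

Section Face.
Context (d : Order.disp_t) (M : ocomplex d).

HB.instance Definition _ := SubFinite.on (face M).

Definition face_le (s t : face M) : bool := val s \subset val t.

Fact face_le_refl : reflexive face_le.
Proof. by move=> s; exact: subxx. Qed.

Fact face_le_anti : antisymmetric face_le.
Proof. by move=> s t st; apply: val_inj; apply/eqP; rewrite finset.eqEsubset. Qed.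

Fact face_le_trans : transitive face_le.
Proof. by move=> t s u; exact: fintype.subset_trans. Qed.

HB.instance Definition _ := Order.Le_isPOrder.Build d (face M)
  face_le_refl face_le_anti face_le_trans.

Fact face_max (s : face M) :
  exists x : M, (x \in val s) && [forall y in val s, (y <= x)%O].
Proof.
have /set0Pn[x0 x0s] := simp_neq0 (valP s).
pose below x := [set y in val s | (y <= x)%O]%SET.
case: (arg_maxnP (fun x : M => #|below x|) x0s) => x xs xmax; exists x.
apply/andP; split; first exact: xs.
apply/forall_inP => y ys; have [//|nyx] := boolP (y <= x)%O.
have xy : (x <= y)%O.
  by have := simp_total (valP s) xs ys; rewrite /Order.comparable (negPf nyx) orbF.
have : below x \proper below y.
  apply/properP; split.
    apply/fintype.subsetP => z; rewrite !inE => /andP[-> zx] /=.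
    exact: le_trans zx xy.
  by exists y; rewrite !inE ys ?lexx.
by move/proper_card; rewrite ltnNge => /negP[]; exact: xmax ys.
Qed.

Definition max_vertex (s : face M) : M := xchoose (face_max s).

Lemma max_vertex_in (s : face M) : max_vertex s \in val s.
Proof. by have /andP[] := xchooseP (face_max s). Qed.

Lemma max_vertex_ge (s : face M) y : y \in val s -> (y <= max_vertex s)%O.
Proof. by have /andP[_ /forall_inP] := xchooseP (face_max s); apply. Qed.
End Face.

Section FaceMap.
Context (d d' : Order.disp_t) (M : ocomplex d) (N : ocomplex d') (f : smap M N).

Definition face_map (s : face M) : face N := Sub (f @: val s) (sfunP f (valP s)).

Fact face_map_homo : {homo face_map : s t / (s <= t)%O}.
Proof. by move=> s t; exact: imsetS. Qed.

HB.instance Definition _ := Order.isOrderMorphism.Build d (face M) d' (face N)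
  face_map face_map_homo.

Lemma max_vertex_face_map (s : face M) :
  {homo f : x y / (x <= y)%O} -> max_vertex (face_map s) = f (max_vertex s).
Proof.
move=> f_homo; apply: le_anti; apply/andP; split.
  have /imsetP[x xs ->] := max_vertex_in (face_map s).
  exact/f_homo/max_vertex_ge.
exact/max_vertex_ge/imset_f/max_vertex_in.
Qed.
End FaceMap.

(** * Barycentric subdivisions *)

Section SubdivisionPoset.
Context (d : Order.disp_t).

Fixpoint sdp (r : nat) (P : finPOrderType d) : finPOrderType d :=
  if r is r'.+1 then face (order_complex (sdp r' P)) else P.

Fixpoint sdp_map (P Q : finPOrderType d) (h : {omorphism P -> Q}) (r : nat) :
    {omorphism sdp r P -> sdp r Q} :=
  match r with
  | 0 => h
  | r'.+1 => face_map (order_complex_map (sdp_map h r'))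
  end.

Definition tau (P : finPOrderType d) : sdp 1 P -> P :=
  @max_vertex d (order_complex P).

Fixpoint tau_iter (P : finPOrderType d) (r : nat) : sdp r P -> P :=
  match r with
  | 0 => id
  | r'.+1 => fun x => tau_iter (@tau (sdp r' P) x)
  end.
End SubdivisionPoset.

Section SubdivisionComplex.
Context (d : Order.disp_t).

Fixpoint sdc (r : nat) (M : ocomplex d) : ocomplex d :=
  if r is r'.+1 then order_complex (face (sdc r' M)) else M.

Fixpoint sdc_map (M N : ocomplex d) (f : smap M N) (r : nat) :
    smap (sdc r M) (sdc r N) :=
  match r with
  | 0 => f
  | r'.+1 => order_complex_map (face_map (sdc_map f r'))
  end.

Fixpoint sdc_comp (M : ocomplex d)
    (a : forall i, smap (sdc i.+1 M) (sdc i M)) (r : nat) : sdc r M -> M :=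
  match r with
  | 0 => id
  | r'.+1 => fun v => sdc_comp a (a r' v)
  end.
End SubdivisionComplex.

(** * Geometric realization *)

Section Realization.
Context (R : realType) (d : Order.disp_t).

Definition support_in (V : finType) (s : {set V}) (x : V -> R) : Prop :=
  forall v, x v != 0 -> v \in s.

Definition geom (M : ocomplex d) : set {ptws M -> R} :=
  [set x | [/\ forall v, 0 <= x v, \sum_v x v = 1 &
               exists2 s, s \in simp M & support_in s x]].

Definition realization (M : ocomplex d) : topologicalType := set_type (@geom M).

(* The affine extension [|f|] of a vertex map, in barycentric coordinates. *)
Definition affine_ext (V W : finType) (f : V -> W) (x : V -> R) (w : W) : R :=
  \sum_(v | f v == w) x v.

(* The homeomorphism from [|sd M|] to [|M|], affine on simplices, which maps
   each vertex [s] of [sd M] to the barycenter of the simplex [s]. *)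
Definition barycentric (M : ocomplex d) (x : sdc 1 M -> R) (v : M) : R :=
  \sum_(s : face M | v \in val s) x s / #|val s|%:R.

(* Every closed simplex of [M] that contains the image in [|M|] of a point of
   [|sd M|] also contains its image under [|f|]. *)
Definition approximates_id (M : ocomplex d) (f : smap (sdc 1 M) M) : Prop :=
  forall x, @geom (sdc 1 M) x ->
  forall s, s \in simp M ->
    support_in s (barycentric x) -> support_in s (affine_ext f x).
End Realization.

(** * Symmetric combinatorial complexity *)

(** ** Powers of a poset *)

Section PosetPower.
Context (d : Order.disp_t) (n : nat).

Definition ppow (P : finPOrderType d) : finPOrderType d := n.-tupleprod[d] P.

Definition pperm (P : finPOrderType d) (g : 'S_n) (x : ppow P) : ppow P :=
  [tuple tnth x (g j) | j < n].

Fact pperm_homo (P : finPOrderType d) (g : 'S_n) :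
  {homo @pperm P g : x y / (x <= y)%O}.
Proof.
move=> x y; rewrite !Order.TupleProdOrder.leEtprod => /forallP xy.
by apply/forallP => j; rewrite !tnth_mktuple.
Qed.

HB.instance Definition _ (P : finPOrderType d) (g : 'S_n) :=
  Order.isOrderMorphism.Build d (ppow P) d (ppow P) (pperm g)
    (@pperm_homo P g).
End PosetPower.

Section PosetExponential.
Context (d d' : Order.disp_t) (J : finPOrderType d) (P : finPOrderType d').

Definition pexp : Type :=
  {f : {ffun J -> P} | [forall a, forall b, (a <= b)%O ==> (f a <= f b)%O]}.

HB.instance Definition _ := SubFinite.on pexp.

Definition pexp_le (f g : pexp) : bool := [forall a, (val f a <= val g a)%O].

Fact pexp_le_refl : reflexive pexp_le.
Proof. by move=> f; apply/forallP. Qed.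

Fact pexp_le_anti : antisymmetric pexp_le.
Proof.
move=> f g /andP[/forallP fg /forallP gf]; apply: val_inj; apply/ffunP => a.
by apply/le_anti; rewrite fg gf.
Qed.

Fact pexp_le_trans : transitive pexp_le.
Proof.
move=> g f h /forallP fg /forallP gh; apply/forallP => a.
exact: le_trans (fg a) (gh a).
Qed.

HB.instance Definition _ := Order.Le_isPOrder.Build d' pexp
  pexp_le_refl pexp_le_anti pexp_le_trans.
End PosetExponential.

(** ** The poset J_(n,m) *)

(* [None] is the common point 0 and [Some (j, t)] is the point (t+1)_j. *)
Definition fences (n m : nat) : Type := option ('I_n * 'I_m).

Section Fences.
Context (n m : nat).

HB.instance Definition _ := Finite.on (fences n m).

(* The point t_j, for t in {0, .., m}; all the points 0_j are equal. *)
Definition fpt (t : 'I_m.+1) (j : 'I_n) : fences n m :=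
  omap (pair j) (unlift ord0 t).

Definition fence_rel : rel (fences n m) := fun a b =>
  [exists j : 'I_n, exists s : 'I_m.+1, exists t : 'I_m.+1,
    [&& a == fpt s j, b == fpt t j, ~~ odd s &
        (t == s.+1 :> nat) || (s == t.+1 :> nat)]].

Definition fence_le : rel (fences n m) := connect fence_rel.

Definition flevel (a : fences n m) : nat := if a is Some (_, t) then t.+1 else 0.

Lemma flevel_fpt t j : flevel (fpt t j) = t.
Proof. by rewrite /fpt; case: unliftP => [t' ->|->]. Qed.

Lemma fence_rel_odd a b : fence_rel a b -> ~~ odd (flevel a) && odd (flevel b).
Proof.
move=> /existsP[j] /existsP[s] /existsP[t] /and4P[/eqP-> /eqP-> se].
rewrite !flevel_fpt se /= => /orP[/eqP->|/eqP st] /=; first exact: se.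
by move: se; rewrite st /= negbK.
Qed.

Lemma fence_leE a b : fence_le a b = (a == b) || fence_rel a b.
Proof.
apply/idP/orP => [|[/eqP->|]]; [|exact: connect0|exact: connect1].
case/connectP => -[|x [|y p]] /=; first by move=> _ ->; left.
  by rewrite andbT => ax ->; right.
move=> /and3P[/fence_rel_odd/andP[_ xo] /fence_rel_odd/andP[xe _]].
by rewrite xo in xe.
Qed.

Fact fence_le_anti : antisymmetric fence_le.
Proof.
move=> a b; rewrite !fence_leE => /andP[/predU1P[//|ab] /predU1P[//|ba]].
move: (fence_rel_odd ab) (fence_rel_odd ba) => /andP[/negbTE ae _] /andP[_].
by rewrite ae.
Qed.
End Fences.

Fact fences_display : Order.disp_t. Proof. exact: Order.Disp tt tt. Qed.

HB.instance Definition _ (n m : nat) :=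
  Order.Le_isPOrder.Build fences_display (fences n m)
    (@connect0 _ (@fence_rel n m)) (@fence_le_anti n m)
    (@connect_trans _ (@fence_rel n m)).

Section CombinatorialComplexity.
Context (d : Order.disp_t) (n : nat) (P : finPOrderType d).

(* The maps [s i] are only relevant on [Q i]. *)
Definition CC_cover (r m k : nat) : Prop :=
  exists (Q : 'I_k -> set (downset_space (sdp r (ppow n P))))
         (s : 'I_k -> downset_space (sdp r (ppow n P)) ->
                      downset_space (pexp (fences n m) P)),
    \bigcup_i Q i = setT /\
    forall i,
    [/\ open (Q i),
        forall g : 'S_n, sdp_map (@pperm d n P g) r @` Q i = Q i,
        {within Q i, continuous (s i)},
        forall (g : 'S_n) x, Q i x -> forall t j,
          val (s i (sdp_map (@pperm d n P g) r x)) (fpt t j) =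
          val (s i x) (fpt t (g j)) &
        forall x, Q i x ->
          forall j, val (s i x) (fpt ord_max j) = tnth (tau_iter x) j].

Definition CCrm (r m : nat) : option nat := least (CC_cover r m).

Definition CCr (r : nat) : option nat := stable_value (CCrm r).

Definition CC : option nat := min_value CCr.
End CombinatorialComplexity.

(** * Symmetric topological complexity *)

Section TopologicalComplexity.
Context (R : realType) (n : nat) (X : topologicalType).

Definition unit_interval : topologicalType :=
  set_type ([set t | 0 <= t <= 1] : set R).

Fact unit_interval0 : (0 : R) \in [set t : R | 0 <= t <= 1].
Proof. by rewrite inE /= lexx ler01. Qed.

Fact unit_interval1 : (1 : R) \in [set t : R | 0 <= t <= 1].
Proof. by rewrite inE /= lexx ler01. Qed.

Definition ui0 : unit_interval := SigSub unit_interval0.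
Definition ui1 : unit_interval := SigSub unit_interval1.

Definition star : topologicalType := wedge (fun _ : 'I_n => ui0).

(* The point t_j. *)
Definition spt (t : unit_interval) (j : 'I_n) : star :=
  wedge_lift (fun _ : 'I_n => ui0) (i := j) t.

Definition star_maps : topologicalType :=
  set_type [set f : {compact-open, star -> X} | continuous f].

Definition xperm (g : 'S_n) (x : {ptws 'I_n -> X}) : {ptws 'I_n -> X} :=
  fun j => x (g j).

(* The maps [s i] are only relevant on [U i]. *)
Definition TC_cover (k : nat) : Prop :=
  exists (U : 'I_k -> set {ptws 'I_n -> X})
         (s : 'I_k -> {ptws 'I_n -> X} -> star_maps),
    \bigcup_i U i = setT /\
    forall i,
    [/\ open (U i),
        forall g : 'S_n, xperm g @` U i = U i,
        {within U i, continuous (s i)},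
        forall (g : 'S_n) x, U i x -> forall t j,
          set_val (s i (xperm g x)) (spt t j) =
          set_val (s i x) (spt t (g j)) &
        forall x, U i x -> forall j, set_val (s i x) (spt ui1 j) = x j].

Definition TC : option nat := least TC_cover.
End TopologicalComplexity.

(** * Symmetric simplicial complexity *)

Section ComplexPower.
Context (d : Order.disp_t) (n : nat) (K : ocomplex d).

Definition cpow_simp : {set {set ppow n K}} :=
  [set s in chains (ppow n K) |
    [forall j : 'I_n, [set tnth x j | x in s] \in simp K]]%SET.

Lemma cpow_simpP (s : {set ppow n K}) :
  reflect (s \in chains (ppow n K) /\
           forall j : 'I_n, [set tnth x j | x in s]%SET \in simp K)
          (s \in cpow_simp).
Proof.
rewrite [X in reflect _ X]finset.in_set.
apply: (iffP idP) => [/andP[sc /forallP sK]|[sc sK]]; first by split.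
by apply/andP; split=> //; apply/forallP.
Qed.

Fact cpow_simp1 (v : ppow n K) : [set v]%SET \in cpow_simp.
Proof.
apply/cpow_simpP; split=> [|j]; first exact: chains1.
by rewrite imset_set1; exact: simp1.
Qed.

Fact cpow_simp_neq0 s : s \in cpow_simp -> s != finset.set0.
Proof. by case/cpow_simpP => /chains_neq0. Qed.

Fact cpow_simpS (s t : {set ppow n K}) :
  s \in cpow_simp -> t \subset s -> t != finset.set0 -> t \in cpow_simp.
Proof.
move=> /cpow_simpP[sc sK] ts t0; apply/cpow_simpP.
split=> [|j]; first exact: chainsS sc ts t0.
apply: (simpS (sK j)); first exact: imsetS ts.
by have /set0Pn[x xt] := t0; apply/set0Pn; exists (tnth x j); exact: imset_f.
Qed.

Fact cpow_simp_total (s : {set ppow n K}) :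
  s \in cpow_simp -> {in s &, forall x y, (x >=< y)%O}.
Proof. by case/cpow_simpP => /chains_total. Qed.

Definition cpow : ocomplex d :=
  OComplex cpow_simp1 cpow_simp_neq0 cpow_simpS cpow_simp_total.

Fact cperm_simplicial (g : 'S_n) : simplicial (simp cpow) (simp cpow) (pperm g).
Proof.
move=> s /cpow_simpP[sc sK]; apply/cpow_simpP; split.
  exact: order_complex_map_simplicial sc.
move=> j; rewrite -imset_comp.
rewrite (eq_imset _ (g := fun x => tnth x (g j))); first exact: sK.
by move=> x /=; rewrite tnth_mktuple.
Qed.

Definition cperm (g : 'S_n) : smap cpow cpow := SMap (cperm_simplicial g).
End ComplexPower.

(* A choice, for each i, of a [Sigma_n]-approximation of the identity
   [sd^(i+1)(K^n) -> sd^i(K^n)]; such choices exist, see below. *)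
Record sym_approximations (R : realType) (d : Order.disp_t) (n : nat)
    (K : ocomplex d) := SymApproximations {
  approx :> forall i, smap (sdc i.+1 (cpow n K)) (sdc i (cpow n K));
  approx_equivariant : forall i (g : 'S_n) v,
    approx i (sdc_map (cperm K g) i.+1 v) = sdc_map (cperm K g) i (approx i v);
  approx_id : forall i, approximates_id R (approx i) }.

Section MaxApproximations.
Context (d : Order.disp_t).

Fact max_vertex_simplicial (M : ocomplex d) :
  simplicial (simp (sdc 1 M)) (simp M) (@max_vertex d M).
Proof.
move=> c c_chain; pose top := max_vertex (exist _ c c_chain : sdp 1 (face M)).
apply: (simpS (valP top)).
  apply/fintype.subsetP => _ /imsetP[s sc ->].
  have /fintype.subsetP : (s <= top)%O.
    exact: (@max_vertex_ge _ (order_complex (face M))).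
  by apply; exact: max_vertex_in.
have /chainsP[/set0Pn[s sc] _] := c_chain.
by apply/set0Pn; exists (max_vertex s); exact: imset_f.
Qed.

Definition max_approx (M : ocomplex d) : smap (sdc 1 M) M :=
  SMap (@max_vertex_simplicial M).

Fact max_approx_id (R : realType) (M : ocomplex d) :
  approximates_id R (max_approx M).
Proof.
move=> x [x_ge0 _ _] s _ supp w; apply: contraNT => /(contraNN (supp w)).
rewrite negbK => /eqP bx0; apply/eqP; apply: big1 => t /eqP tw.
have wt : w \in val t by rewrite -tw; exact: max_vertex_in.
have /psumr_eq0P/(_ t wt)/eqP : barycentric x w = 0 by [].
rewrite mulf_eq0 invr_eq0 pnatr_eq0 cards_eq0.
rewrite (negPf (simp_neq0 (valP t))) orbF => /(_ _)/eqP; apply => u _.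
by rewrite divr_ge0.
Qed.

Variables (n : nat) (K : ocomplex d).

Fact sdc_perm_homo (g : 'S_n) i :
  {homo sdc_map (cperm K g) i : x y / (x <= y)%O}.
Proof. by case: i => [|i]; [exact: pperm_homo|exact: face_map_homo]. Qed.

Definition max_approximations (R : realType) : sym_approximations R n K :=
  @SymApproximations R d n K (fun i => max_approx (sdc i (cpow n K)))
    (fun i g v => max_vertex_face_map v (@sdc_perm_homo g i))
    (fun i => @max_approx_id R (sdc i (cpow n K))).
End MaxApproximations.

(* [M] is a complex on (some of) the elements of [V], [act] is the action of
   [Sigma_n] on its vertices, and maps out of [V] are only relevant on vertices
   of [M]. *)
Definition sym_contiguous (n : nat) (V W : finType) (act : 'S_n -> V -> V)
    (M : {set {set V}}) (N : {set {set W}}) (phi : 'I_n -> V -> W) : Prop :=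
  exists (phi0 : V -> W) (c : nat) (psi : nat -> 'I_n -> V -> W),
  [/\ simplicial M N phi0 /\
        (forall (g : 'S_n) v, [set v]%SET \in M -> phi0 (act g v) = phi0 v),
      (1 <= c)%N,
      forall j l, (l <= c)%N -> simplicial M N (psi l j),
      forall j v, [set v]%SET \in M -> psi 0 j v = phi0 v /\ psi c j v = phi j v &
      (forall j l s, (1 <= l <= c)%N -> s \in M ->
         psi l.-1 j @: s :|: psi l j @: s \in N) /\
      (forall (g : 'S_n) j l v, (l <= c)%N -> [set v]%SET \in M ->
         psi l j (act g v) = psi l (g j) v)].

Section SimplicialComplexity.
Context (R : realType) (d : Order.disp_t) (n : nat) (K : ocomplex d).
Variable a : sym_approximations R n K.

Definition SC_cover (r k : nat) : Prop :=
  exists L : 'I_k -> {set {set sdc r (cpow n K)}},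
    (\bigcup_i L i)%SET = simp (sdc r (cpow n K)) /\
    forall i,
    [/\ subcomplex (L i),
        forall g : 'S_n,
          [set sdc_map (cperm K g) r @: (s : {set _}) | s in L i]%SET = L i &
        sym_contiguous (fun g => sdc_map (cperm K g) r) (L i) (simp K)
          (fun j v => tnth (sdc_comp a v) j)].

Definition SCr (r : nat) : option nat := least (SC_cover r).

Definition SC : option nat := min_value SCr.
End SimplicialComplexity.

(* Main.v *)
Require Import Defs.
From HB Require Import structures.
From mathcomp Require Import all_boot all_order all_algebra all_fingroup.
From mathcomp Require Import all_classical all_reals topology wedge_sigT.
From mathcomp Require Import normedtype sequences.
From mathcomp Require Import ring zify.

(** Covers by [k] sets are transported around a cycle, for a fixed [k].

    From CC to SC: on the chains of an invariant open set [Q], two comparable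
    order preserving maps become symmetrically contiguous by changing the values
    one rank at a time; since the rank is invariant, so are the intermediate maps.

    From SC to CC: a subcomplex of [sd^r] is an open set of the next subdivision,
    and the maxima of [psi_l(s)], [psi_l(s) \cup psi_(l+1)(s)], [psi_(l+1)(s)]
    form a piece of fence.

    From CC to TC: [|K(P)|^n] is mapped continuously and equivariantly to
    [|K(sd^r(P^n))|] in such a way that the supports of the images under the
    projections do not grow. Exact inverses of the canonical homeomorphisms are
    thus not needed: contiguity gives polygonal lines, and a last segment leads
    to the given point.

    From TC to SC: after enough subdivisions, a Lebesgue number argument provides
    simplicial approximations at the times [l / c] of the paths given by the
    sections. The choice of the vertices is automatically equivariant, because it
    only depends on the set of admissible vertices. *)

Set Implicit Arguments.
Unset Strict Implicit.
Unset Printing Implicit Defensive.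

Import Order.TTheory GRing.Theory Num.Theory.
Import numFieldNormedType.Exports.

Local Open Scope classical_set_scope.
Local Open Scope ring_scope.

(** * Extended minima *)

(** Each of the three numbers is an infimum over auxiliary data, so a passage may enlarge [r] and
    [m] freely: a subcomplex becomes open only one subdivision later, and a Lebesgue number dictates
    [r] when sections are given. Equivariance shapes the constructions. A choice made separately at
    each point need not be compatible with stabilizers, so every value is read off from data that
    the group permutes: ranks, maxima of chains, formulas in barycentric coordinates, sets of
    admissible vertices. Another obstacle is that [K(P)^n] and [K(P^n)] have the same simplices
    without being convertible; they are compared once, bundled with their symmetries, and the
    equality is carried through subdivision. Continuity of sections is handled leg by leg: a map
    into the compact-open space over the star is continuous at a point exactly when each leg is
    jointly continuous there in the point and the time. *)

Lemma least_some (A : set nat) k :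
  least A = Some k <-> A k /\ forall l, A l -> (k <= l)%N.
Proof.
rewrite /least; case: pselect => [e|ne]; last first.
  split=> // -[Ak _]; case: ne; exists k; exact/asboolP.
case: ex_minnP => m /asboolP Am m_min; split=> [[<-]|[Ak k_min]].
  by split=> // l Al; apply: m_min; exact/asboolP.
congr Some; apply/eqP; rewrite eqn_leq k_min// andbT.
by apply: m_min; exact/asboolP.
Qed.

Lemma least_none (A : set nat) : least A = None <-> forall k, ~ A k.
Proof.
rewrite /least; case: pselect => [e|ne]; split=> //.
  by have [k /asboolP Ak] := e; move=> /(_ _ Ak).
by move=> _ k Ak; case: ne; exists k; exact/asboolP.
Qed.

Lemma eq_least (A B : set nat) : (forall k, A k <-> B k) -> least A = least B.
Proof. by move=> AB; congr least; apply/seteqP; split=> k /AB. Qed.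

Lemma min_value_least (A : nat -> set nat) :
  min_value (fun r => least (A r)) = least [set k | exists r, A r k].
Proof.
rewrite /min_value.
case e: (least [set k | exists r, A r k]) => [k|].
  apply/least_some; have /least_some := e; move=> [[r Ark] k_min]; split.
    by exists r; apply/least_some; split=> // l Al; apply: k_min; exists r.
  by move=> l [r' /least_some[Al _]]; apply: k_min; exists r'.
apply/least_none => k [r /least_some[Ark _]].
by have /least_none/(_ k) := e; apply; exists r.
Qed.

(** A smallest [k] attained at some [m0] stays attained for all larger [m], so the sequence of
    minima is constant from [m0] on; if nothing is attained, it is constantly [None]. *)
Lemma stable_value_least (A : nat -> set nat) :
  (forall m k, A m k -> A m.+1 k) ->
  stable_value (fun m => least (A m)) = least [set k | exists m, A m k].
Proof.
move=> AS.
have homoA m m' k : (m <= m')%N -> A m k -> A m' k.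
  move=> /subnK <-; elim: (m' - m)%N => // p IH Am; exact/AS/IH.
set v := RHS.
have vP : \forall m \near \oo, least (A m) = v.
  rewrite /v; case e: (least _) => [k|].
    have /least_some := e; move=> [[m0 Ak] k_min]; exists m0 => // m /= m0m.
    apply/least_some; split; first exact: homoA Ak.
    by move=> l Al; apply: k_min; exists m.
  near=> m; apply/least_none => k Ak.
  by have /least_none/(_ k) := e; apply; exists m.
apply: xget_unique => //= w wP.
by near \oo => m; rewrite -(near vP m)// (near wP m).
Unshelve. all: by end_near. Qed.

(** * Symmetric contiguity *)

Section Contiguity.
Context (n : nat) (V W : finType) (act : 'S_n -> V -> V).
Variables (M : {set {set V}}) (N : {set {set W}}).

Definition equivariant_on (phi : 'I_n -> V -> W) : Prop :=
  forall (g : 'S_n) j v, [set v]%SET \in M -> phi j (act g v) = phi (g j) v.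

Lemma sym_contiguous_cst (phi0 : V -> W) : simplicial M N phi0 ->
  (forall (g : 'S_n) v, [set v]%SET \in M -> phi0 (act g v) = phi0 v) ->
  sym_contiguous act M N (fun=> phi0).
Proof.
move=> sphi0 iphi0; exists phi0, 1, (fun _ _ => phi0); split=> //; split=> //.
  by move=> j l s _ sM; rewrite finset.setUid; exact: sphi0.
by move=> g j l v _; exact: iphi0.
Qed.

Hypothesis vertexM : forall s v, s \in M -> v \in s -> [set v]%SET \in M.

(** Symmetric contiguities are built by induction with this lemma, one link at a time. Since [psi c]
    agrees with [phi] only at the vertices of [M], [vertexM] is what makes their images of a simplex
    equal. *)
Lemma sym_contiguous_step (phi phi' : 'I_n -> V -> W) :
  sym_contiguous act M N phi ->
  (forall j, simplicial M N (phi' j)) -> equivariant_on phi' ->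
  (forall j s, s \in M -> (phi j @: s :|: phi' j @: s)%SET \in N) ->
  sym_contiguous act M N phi'.
Proof.
move=> [phi0 [c [psi [[sphi0 iphi0] c1 spsi epsi [cpsi ipsi]]]]] sphi' iphi'
  cphi.
exists phi0, c.+1, (fun l => if (l <= c)%N then psi l else phi'); split=> //.
- by move=> j l _; case: leqP => [lc|_]; [exact: spsi|exact: sphi'].
- by move=> j v vM; rewrite ltnn; split=> //; have [] := epsi j v vM.
split=> [j l s /andP[l1 lc] sM|g j l v _ vM]; last first.
  by case: leqP => lc; [exact: ipsi|exact: iphi'].
have [lc'|lc'] := leqP l c.
  by rewrite (leq_trans (leq_pred _) lc'); apply: cpsi => //; rewrite l1.
have -> : l = c.+1 by apply/eqP; rewrite eqn_leq lc.
rewrite /= leqnn.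
have -> : (psi c j @: s = phi j @: s)%SET; last exact: cphi.
by apply: eq_in_imset => v vs; have [] := epsi j v (vertexM sM vs).
Qed.
End Contiguity.

Lemma subcomplex_vertex (d : Order.disp_t) (M : ocomplex d) (L : {set {set M}})
  :
  subcomplex L -> forall s v, s \in L -> v \in s -> [set v]%SET \in L.
Proof.
move=> [_ subL] s v sL vs; apply: subL sL _ _; first by rewrite finset.sub1set.
by apply/set0Pn; exists v; rewrite inE.
Qed.

Lemma simp_subset (d : Order.disp_t) (M : ocomplex d) (s t : {set M}) x :
  s \in simp M -> x \in t -> t \subset s -> t \in simp M.
Proof. by move=> sM xt ts; apply: simpS sM ts _; apply/set0Pn; exists x. Qed.

(** * Carriers in iterated subdivisions *)

Section Carriers.
Context (d : Order.disp_t) (M : ocomplex d).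

(** The vertices of the smallest simplex of [M] that contains the point of [|M|] named by the vertex
    of the subdivision. *)
Fixpoint carrier (r : nat) : sdc r M -> {set M} :=
  match r with
  | 0 => fun v => [set v]%SET
  | r'.+1 => fun v : face (sdc r' M) => (\bigcup_(u in val v) carrier u)%SET
  end.

Lemma carrier_simp r (s : {set sdc r M}) :
  s \in simp (sdc r M) -> (\bigcup_(v in s) carrier v)%SET \in simp M.
Proof.
elim: r s => [|r IH] s sM /=.
  rewrite [X in X \in _](_ : _ = s)//.
  apply/setP => x; apply/bigcupP/idP => [[v vs /set1P->]//|xs].
  by exists x => //; rewrite inE.
(* The faces in [s] form a chain, so the union of their carriers is already that of the largest
   face, which is a simplex one level down. *)
pose top := max_vertex (exist _ s sM : face (sdc r.+1 M)).
rewrite [X in X \in _](_ : _ = \bigcup_(u in val top) carrier u)%SET.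
  exact/IH/valP.
apply/eqP; rewrite finset.eqEsubset; apply/andP; split.
  apply/bigcupsP => v vs; apply/bigcupsP => u uv.
  apply: (finset.bigcup_sup u) => //.
  have /fintype.subsetP : (v <= top)%O by exact: (@max_vertex_ge _ (sdc r.+1
    M)).
  exact.
apply: (finset.bigcup_sup top) => //.
exact: (@max_vertex_in _ (sdc r.+1 M) (exist _ s sM)).
Qed.

Lemma sdc_comp_carrier (a : forall i, smap (sdc i.+1 M) (sdc i M)) :
  (forall i (v : face (sdc i M)), a i v \in val v) ->
  forall r (v : sdc r M), sdc_comp a v \in carrier v.
Proof.
move=> av; elim=> [|r IH] v /=; first by rewrite inE.
by apply/bigcupP; exists (a r v) => //; exact: av.
Qed.
End Carriers.

(** * Simplicial approximations of the identity stay in carriers *)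

Section ApproxVertex.
Context (R : realType) (d : Order.disp_t).

Definition unit_mass (V : finType) (v : V) : V -> R := fun u => (u == v)%:R.

Lemma sum_unit_mass (V : finType) (v : V) (f : V -> R) :
  \sum_u unit_mass v u * f u = f v.
Proof.
rewrite (bigD1 v)//= /unit_mass eqxx mul1r big1 ?addr0// => u /negPf->.
by rewrite mul0r.
Qed.

Lemma unit_mass_geom (M : ocomplex d) (v : M) :
  @geom R d M (unit_mass v).
Proof.
split=> [u||]; first exact: ler0n.
  by rewrite -[LHS](eq_bigr _ (fun u _ => mulr1 (unit_mass v u))) sum_unit_mass.
exists [set v]%SET; first exact: simp1.
by move=> u; rewrite /unit_mass inE; case: (u == v) => //; rewrite eqxx.
Qed.

(** The approximation condition is tested at the vertex [v] of [sd M] itself: its barycentric image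
    is supported by the simplex [v], and its affine image is the unit mass at [f v]. *)
Lemma approximates_id_in (M : ocomplex d) (f : smap (sdc 1 M) M)
  (v : face M) : approximates_id R f -> f v \in val v.
Proof.
move=> /(_ _ (@unit_mass_geom (sdc 1 M) v) _ (valP v)); apply.
  move=> u; apply: contraR => uv; apply/eqP/big1 => s us; rewrite /unit_mass.
  by have [sv|_] := eqVneq s v; rewrite ?mul0r//; rewrite sv (negPf uv) in us.
rewrite /affine_ext (bigD1 v)//= big1 ?addr0 /unit_mass ?eqxx ?oner_eq0//.
by move=> u /andP[_ /negPf->].
Qed.
End ApproxVertex.

Lemma cpow_projection (d : Order.disp_t) n (K : ocomplex d) j
  (s : {set ppow n K}) : s \in simp (cpow n K) ->
  ((fun x : ppow n K => tnth x j) @: s)%SET \in simp K.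
Proof. by case/cpow_simpP => _ /(_ j). Qed.

Lemma sdc_comp_equivariant (R : realType) (d : Order.disp_t) n (K : ocomplex d)
  (a : sym_approximations R n K) r (g : 'S_n) (v : sdc r (cpow n K)) :
  sdc_comp a (sdc_map (cperm K g) r v) = pperm g (sdc_comp a v).
Proof.
elim: r v => //= r IH v.
by rewrite -IH; congr (sdc_comp a _); exact: approx_equivariant.
Qed.

Lemma tnth_pperm (d : Order.disp_t) n (P : finPOrderType d) (g : 'S_n)
  (x : ppow n P) j : tnth (pperm g x) j = tnth x (g j).
Proof. by rewrite tnth_mktuple. Qed.

Section ApproxIndependence.
Context (R : realType) (d : Order.disp_t) (n : nat) (K : ocomplex d).

(** Whatever the approximations, a vertex is sent into its carrier; both composites therefore map
    [s] into the projection of one simplex of [K^n]. *)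
Lemma approx_contiguous (a a' : sym_approximations R n K) r j
    (s : {set sdc r (cpow n K)}) : s \in simp (sdc r (cpow n K)) ->
  ((fun v => tnth (sdc_comp a v) j) @: s :|:
   (fun v => tnth (sdc_comp a' v) j) @: s)%SET \in simp K.
Proof.
move=> sM; have cs := cpow_projection j (carrier_simp sM).
have /set0Pn[v vs] := simp_neq0 sM.
have in_carrier (b : sym_approximations R n K) u : u \in s ->
    tnth (sdc_comp b u) j \in
    ((fun x : ppow n K => tnth x j) @: (\bigcup_(v in s) carrier v))%SET.
  move=> us; apply/imsetP; exists (sdc_comp b u) => //.
  apply/bigcupP; exists u => //.
  apply: (@sdc_comp_carrier _ (cpow n K) b) => i w.
  exact: (@approximates_id_in R d (sdc i (cpow n K)) (b i) w (@approx_id R d n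
    K b i)).
apply: (simp_subset (x := tnth (sdc_comp a v) j) cs).
  by rewrite inE; apply/orP; left; apply/imsetP; exists v.
apply/fintype.subsetP => w /setUP[] /imsetP[u us ->]; exact: in_carrier.
Qed.

Lemma approx_simplicial (a : sym_approximations R n K) r j :
  simplicial (simp (sdc r (cpow n K))) (simp K)
    (fun v => tnth (sdc_comp a v) j).
Proof.
by move=> s sM; have := approx_contiguous a a j sM; rewrite finset.setUid.
Qed.

Lemma SC_cover_indep (a a' : sym_approximations R n K) r k :
  SC_cover a r k -> SC_cover a' r k.
Proof.
move=> [L [UL LP]]; exists L; split=> // i.
have [subL invL cL] := LP i; split=> //.
have LM s : s \in L i -> s \in simp (sdc r (cpow n K)).
  by have [/fintype.subsetP + _] := subL; apply.
apply: (sym_contiguous_step (subcomplex_vertex subL) cL).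
- by move=> j s /LM; exact: approx_simplicial.
- by move=> g j v _; rewrite sdc_comp_equivariant tnth_pperm.
- by move=> j s /LM; exact: approx_contiguous.
Qed.
End ApproxIndependence.

(** * Subdivisions of order complexes *)

Section Tower.
Context (d : Order.disp_t) (n : nat) (P : finPOrderType d).

(* A complex, a family of symmetries of it and a map to [P^n]. An equality of
   towers carries the symmetries and the map along the equality of complexes. *)
Definition tower : Type :=
  {M : ocomplex d & (('S_n -> smap M M) * (M -> ppow n P))%type}.

Definition SC_tower (T : tower) (k : nat) : Prop :=
  exists L : 'I_k -> {set {set tag T}},
    (\bigcup_i L i)%SET = simp (tag T) /\
    forall i,
    [/\ subcomplex (L i),
        forall g : 'S_n,
          [set (tagged T).1 g @: (s : {set _}) | s in L i]%SET = L i &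
        sym_contiguous (fun g => (tagged T).1 g) (L i) (simp (order_complex P))
          (fun j v => tnth ((tagged T).2 v) j)].

Definition tower_sdc r : tower :=
  existT _ (sdc r (cpow n (order_complex P)))
    (fun g => sdc_map (cperm (order_complex P) g) r,
     fun v => sdc_comp
       (fun i => max_approx (sdc i (cpow n (order_complex P)))) v).

Definition poset_tower (S : finPOrderType d) (act : 'S_n -> {omorphism S -> S})
    (iota : S -> ppow n P) : tower :=
  existT _ (order_complex S) (fun g => order_complex_map (act g), iota).

(** Both towers of subdivisions, with [max_approx] on one side and [tau] on the other, are iterates
    of this operation, so an equality at [r = 0] propagates to all [r]. *)
Definition tower_step (T : tower) : tower :=
  existT _ (order_complex (face (tag T)))
    (fun g => order_complex_map (face_map ((tagged T).1 g)),
     fun v : face (tag T) => (tagged T).2 (max_vertex v)).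

Lemma cpow_simp_order_complex :
  simp (cpow n (order_complex P)) = chains (ppow n P).
Proof.
apply/setP => s; apply/cpow_simpP/idP => [[]//|sc]; split=> // j.
have /chainsP[/set0Pn[x xs] s_total] := sc.
apply/chainsP; split; first by apply/set0Pn; exists (tnth x j); exact: imset_f.
move=> _ _ /imsetP[y ys ->] /imsetP[z zs ->].
by case/orP: (s_total _ _ ys zs); rewrite Order.TupleProdOrder.leEtprod =>
  /forallP/(_ j) le_j; apply/orP; [left|right].
Qed.

Lemma cpow_order_complex :
  tower_sdc 0 = poset_tower (fun g : 'S_n => @pperm d n P g) id.
Proof.
(* With the set of simplices as a variable, an equality of sets can be substituted; only proofs are
   then left to compare. *)
pose complex_tower (simpl : {set {set ppow n P}}) h1 h2 h3 h4
    (hg : forall g : 'S_n, simplicial simpl simpl (@pperm d n P g)) : tower :=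
  existT _ (@OComplex d (ppow n P) simpl h1 h2 h3 h4)
    (fun g => @SMap d d (OComplex h1 h2 h3 h4) (OComplex h1 h2 h3 h4)
       (pperm g) (hg g), id).
have tower_irr S S' h1 h2 h3 h4 hg h1' h2' h3' h4' hg' : S = S' ->
    @complex_tower S h1 h2 h3 h4 hg = @complex_tower S' h1' h2' h3' h4' hg'.
  move=> SS'; subst S'.
  rewrite (Prop_irrelevance h1 h1') (Prop_irrelevance h2 h2').
  rewrite (Prop_irrelevance h3 h3') (Prop_irrelevance h4 h4').
  by rewrite (Prop_irrelevance hg hg').
exact: (@tower_irr _ _ _ _ _ _ (@cperm_simplicial d n (order_complex P)) _ _ _ _
  (fun g => sfunP (order_complex_map (@pperm d n P g)))
  cpow_simp_order_complex).
Qed.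

Lemma tower_sdc_sdp r :
  tower_sdc r =
  poset_tower (fun g : 'S_n => sdp_map (@pperm d n P g) r) (@tau_iter _ _ r).
Proof.
elim: r => [|r IH]; first exact: cpow_order_complex.
by transitivity (tower_step (tower_sdc r)); last rewrite IH.
Qed.
End Tower.

(** * Combinatorial and simplicial complexity *)

Lemma sdp_mapK (d : Order.disp_t) (P Q : finPOrderType d)
    (h : {omorphism P -> Q}) (h' : {omorphism Q -> P}) r :
  cancel h h' -> cancel (sdp_map h r) (sdp_map h' r).
Proof.
move=> hK; elim: r => [//|r IH] s; apply: val_inj => /=.
rewrite -imset_comp (eq_imset _ (g := id)) ?imset_id// => x; exact: IH.
Qed.

Lemma ppermK (d : Order.disp_t) n (P : finPOrderType d) (g : 'S_n) :
  cancel (@pperm d n P g) (@pperm d n P g^-1%g).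
Proof. by move=> x; apply: eq_from_tnth => j; rewrite !tnth_pperm permKV. Qed.

Lemma max_vertex_le (d : Order.disp_t) (M : ocomplex d) (s t : face M) :
  (s <= t)%O -> (max_vertex s <= max_vertex t)%O.
Proof.
by move=> /fintype.subsetP st; apply/max_vertex_ge/st/max_vertex_in.
Qed.

Lemma tau_iter_homo (d : Order.disp_t) (P : finPOrderType d) r :
  {homo @tau_iter d P r : x y / (x <= y)%O}.
Proof. by elim: r => [//|r IH] x y /max_vertex_le; exact: IH. Qed.

(** The principal down-set of a point is its smallest neighbourhood, so continuity is tested on it
    alone. *)
Lemma within_downset_continuous (d d' : Order.disp_t) (S : porderType d)
    (T : porderType d') (Q : set (downset_space S))
    (s : downset_space S -> downset_space T) : open Q ->
  {within Q, continuous s} <->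
  (forall x y : S, Q x -> (y <= x)%O -> (s y <= s x :> T)%O).
Proof.
move=> oQ; rewrite continuous_open_subspace//; split=> [cs x y Qx yx|s_homo x].
  have below : open ([set f | (f <= s x)%O] : set (downset_space T)).
    by move=> f f' f'f /= /(le_trans f'f).
  have : nbhs (s x : downset_space T) [set f | (f <= s x :> T)%O].
    by apply: open_nbhs_nbhs; split=> //=.
  move/(cs x (mem_set Qx)) => -[B [oB Bx]]; apply.
  exact: oB yx Bx.
rewrite inE => Qx A [B [oB Bsx BA]].
exists ([set y | (y <= x :> S)%O]); split=> [y z zy /=|//=|y /= yx].
  exact: le_trans.
by apply/BA/(oB (s x)) => //; exact: s_homo.
Qed.

Section PosetComplexity.
Context (d : Order.disp_t) (n : nat) (P S : finPOrderType d).
Variables (act : 'S_n -> {omorphism S -> S}) (iota : S -> ppow n P).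

(** [CC_cover n P r m] is the instance [S = sd^r(P^n)]; an arbitrary [S] hides the iterated
    subdivision. *)
Definition CC_poset (m k : nat) : Prop :=
  exists (Q : 'I_k -> set (downset_space S))
         (s : 'I_k -> downset_space S -> downset_space (pexp (fences n m) P)),
    \bigcup_i Q i = setT /\
    forall i,
    [/\ open (Q i),
        forall g : 'S_n, act g @` Q i = Q i,
        {within Q i, continuous (s i)},
        forall (g : 'S_n) x, Q i x -> forall t j,
          val (s i (act g x)) (fpt t j) = val (s i x) (fpt t (g j)) &
        forall x, Q i x ->
          forall j, val (s i x) (fpt ord_max j) = tnth (iota x) j].

Hypothesis actK : forall g, cancel (act g) (act g^-1%g).

Let actKV g : cancel (act g^-1%g) (act g).
Proof. by move=> x; rewrite -{1}(invgK g) actK. Qed.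

(** A substitute for height: strictly increasing, invariant under automorphisms, with values between
    1 and [#|S|]. *)
Definition rank (v : S) : nat := #|[set u : S | (u <= v)%O]%SET|.

Lemma rank_lt (u v : S) : (u < v)%O -> (rank u < rank v)%N.
Proof.
move=> uv; apply/proper_card/properP; split.
  by apply/fintype.subsetP => w; rewrite !inE => /le_trans/(_ (ltW uv)).
by exists v; rewrite !inE ?lexx// lt_geF.
Qed.

Lemma rank_act g v : rank (act g v) = rank v.
Proof.
rewrite /rank -[RHS](card_imset _ (can_inj (actK g))); congr #|pred_of_set _|.
apply/setP => u; rewrite inE; apply/idP/imsetP => [ugv|[w]].
  exists (act g^-1%g u); last by rewrite actKV.
  by rewrite inE -(actK g v); exact: omorph_le.
by rewrite inE => wv ->; exact: omorph_le.
Qed.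

Definition chains_in (Q : {set S}) : {set {set S}} :=
  [set s in chains S | s \subset Q]%SET.

Lemma chains_inP (Q s : {set S}) :
  reflect (s \in chains S /\ {subset s <= Q}) (s \in chains_in Q).
Proof.
rewrite [X in reflect _ X]finset.in_set.
by apply: (iffP andP) => -[? /fintype.subsetP].
Qed.

Lemma chains_in1 (Q : {set S}) v : ([set v]%SET \in chains_in Q) = (v \in Q).
Proof.
apply/chains_inP/idP => [[_]|vQ]; first by apply; rewrite inE.
by split=> [|u /set1P->//]; exact: chains1.
Qed.

Lemma chains_in_vertex (Q s : {set S}) v :
  s \in chains_in Q -> v \in s -> [set v]%SET \in chains_in Q.
Proof. by rewrite chains_in1 => /chains_inP[_]; exact. Qed.

Lemma chains_image (Q s : {set S}) (f : S -> P) : s \in chains_in Q ->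
  {in Q &, {homo f : x y / (x <= y)%O}} -> f @: s \in chains P.
Proof.
move=> /chains_inP[/chainsP[/set0Pn[x xs] s_total] sQ] f_homo.
apply/chainsP; split; first by apply/set0Pn; exists (f x); exact: imset_f.
move=> _ _ /imsetP[y ys ->] /imsetP[z zs ->].
case/orP: (s_total _ _ ys zs) => yz; apply/orP; [left|right];
  by apply: f_homo => //; exact: sQ.
Qed.

Lemma chains_imageU (Q s : {set S}) (f g : S -> P) : s \in chains_in Q ->
  {in Q &, {homo f : x y / (x <= y)%O}} ->
  {in Q &, {homo g : x y / (x <= y)%O}} ->
  {in Q, forall x, (f x >=< g x)%O} ->
  {in Q &, forall x y, (x < y)%O -> (f x <= g y)%O && (g x <= f y)%O} ->
  (f @: s :|: g @: s)%SET \in chains P.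
Proof.
move=> sQ f_homo g_homo fg_comp fg_homo.
have /chainsP[+ f_total] := chains_image sQ f_homo.
have /chainsP[_ g_total] := chains_image sQ g_homo.
move: sQ => /chains_inP[/chainsP[_ s_total] sQ] /set0Pn[x xs].
have fg x' y' : x' \in s -> y' \in s -> (f x' >=< g y')%O.
  move=> xs' ys'; have [<-|/eqP xy] := eqVneq x' y'; first exact/fg_comp/sQ.
  case: (comparable_ltgtP (s_total _ _ xs' ys')) => [xy'|xy'|/xy//].
  - have /andP[fg _] := fg_homo _ _ (sQ _ xs') (sQ _ ys') xy'.
    by apply/orP; left.
  - have /andP[_ gf] := fg_homo _ _ (sQ _ ys') (sQ _ xs') xy'.
    by apply/orP; right.
apply/chainsP; split; first by apply/set0Pn; exists x; rewrite inE xs.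
move=> y z /setUP[yf|yg] /setUP[zf|zg]; [exact: f_total| | |exact: g_total].
  by move: yf zg => /imsetP[y' ys ->] /imsetP[z' zs ->]; exact: fg.
by move: yg zf => /imsetP[y' ys ->] /imsetP[z' zs ->];
  rewrite comparable_sym; exact: fg.
Qed.
End PosetComplexity.

(** * Contiguity of comparable order preserving maps *)

Section OrderHomotopy.
Context (d : Order.disp_t) (n : nat) (P S : finPOrderType d).
Variables (act : 'S_n -> {omorphism S -> S}) (Q : {set S}).
Hypothesis actK : forall g, cancel (act g) (act g^-1%g).

Local Notation contiguous :=
  (sym_contiguous (fun g => act g) (chains_in Q) (chains P)).
Local Notation equivariant f :=
  (forall (g : 'S_n) j v, v \in Q -> f j (act g v) = f (g j) v).

Variables f g : 'I_n -> S -> P.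
Hypothesis f_homo : forall j, {in Q &, {homo f j : x y / (x <= y)%O}}.
Hypothesis g_homo : forall j, {in Q &, {homo g j : x y / (x <= y)%O}}.
Hypotheses (f_equiv : equivariant f) (g_equiv : equivariant g).

Definition mix (A : nat -> pred S) k j v := if A k v then g j v else f j v.

(** The condition on stages that differ by at most one has two uses: [k = l] makes each stage order
    preserving, and neighbouring stages send a chain into a common chain. *)
Lemma mix_contiguous (A : nat -> pred S) :
  (forall k (g : 'S_n) v, A k (act g v) = A k v) ->
  (forall j, {in Q, forall v, (f j v >=< g j v)%O}) ->
  (forall k l j, (k <= l.+1)%N -> (l <= k.+1)%N ->
    {in Q &, forall x y, (x < y)%O -> (mix A k j x <= mix A l j y)%O}) ->
  contiguous (mix A 0) -> forall k, contiguous (mix A k).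
Proof.
move=> A_inv fg mix_lt cf; elim=> // k ck.
have mix_homo l j : {in Q &, {homo mix A l j : x y / (x <= y)%O}}.
  by move=> x y xQ yQ; rewrite le_eqVlt => /predU1P[->//|]; exact: mix_lt.
apply: (sym_contiguous_step (@chains_in_vertex _ _ _) ck).
- by move=> j s /chains_image; apply; exact: mix_homo.
- move=> g0 j v; rewrite chains_in1 => vQ.
  by rewrite /mix A_inv g_equiv// f_equiv.
- move=> j s sQ; apply: chains_imageU sQ _ _ _ _ => //.
    move=> x xQ; rewrite /mix.
    by case: ifP; case: ifP; rewrite ?comparablexx ?fg// comparable_sym fg.
  by move=> x y xQ yQ xy; apply/andP; split; apply: mix_lt;
    rewrite // -addn2 leq_addr.
Qed.

(* The values at the points of rank [k] are changed one rank at a time,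
   starting from the top. *)
Lemma order_homotopy_up : (forall j, {in Q, forall v, (f j v <= g j v)%O}) ->
  contiguous f -> contiguous g.
Proof.
(* At stage [k] the points of rank above [#|S| - k] have moved. As ranks lie between 1 and [#|S|],
   nothing has moved at stage 0 and everything at stage [#|S|]. *)
move=> fg cf; pose A k := [pred v : S | (#|S| < rank v + k)%N].
have mix0 : mix A 0 = f.
  by apply/funext => j; apply/funext => v;
    rewrite /mix /= addn0 ltnNge max_card.
have mixS : mix A #|S| = g.
  apply/funext => j; apply/funext => v; rewrite /mix /= -addn1 addnC leq_add2r.
  by rewrite (_ : 0 < rank v)%N//; apply/card_gt0P; exists v; rewrite inE.
rewrite -mixS; apply: mix_contiguous =>
  [k h v|j v vQ|k l j kl lk x y xQ yQ xy|].
- by rewrite /= rank_act.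
- by apply/orP; left; exact: fg.
- have := rank_lt xy; rewrite /mix /= => rxy.
  have := ltW xy => lexy.
  case: ifPn => [Ax|_]; last by case: ifP => _;
    [exact: le_trans (f_homo j xQ yQ lexy) (fg _ _ yQ)|exact: f_homo].
  (* If [x] has moved at stage [k], then [y], of larger rank, has moved at stage [l], which is at
     least [k - 1]. *)
  rewrite ifT; first exact: g_homo.
  apply: (leq_trans Ax); apply: (@leq_trans ((rank x).+1 + l)).
    by rewrite addSn -addnS leq_add2l.
  by rewrite leq_add2r.
- by rewrite mix0.
Qed.

(** Decreasing values are changed from the bottom: if [y] has moved at stage [l], then [x < y] has
    rank at most [l - 1] and has moved at stage [k]; otherwise [y] keeps its larger value. *)
Lemma order_homotopy_down : (forall j, {in Q, forall v, (g j v <= f j v)%O}) ->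
  contiguous f -> contiguous g.
Proof.
move=> gf cf; pose A k := [pred v : S | (rank v <= k)%N].
have mix0 : mix A 0 = f.
  apply/funext => j; apply/funext => v; rewrite /mix /= leqn0 ifF//.
  by apply/negbTE; rewrite -lt0n; apply/card_gt0P; exists v; rewrite inE.
have mixS : mix A #|S| = g.
  by apply/funext => j; apply/funext => v; rewrite /mix /= max_card.
rewrite -mixS; apply: mix_contiguous =>
  [k h v|j v vQ|k l j kl lk x y xQ yQ xy|].
- by rewrite /= rank_act.
- by apply/orP; right; exact: gf.
- have := rank_lt xy; rewrite /mix /= => rxy.
  have := ltW xy => lexy.
  case: (leqP (rank y) l) => [Ay|_]; last by case: ifP => _;
    [exact: le_trans (gf _ _ xQ) (f_homo j xQ yQ lexy)|exact: f_homo].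
  rewrite ifT; first exact: g_homo.
  by rewrite -ltnS; apply: (leq_trans rxy); exact: (leq_trans Ay).
- by rewrite mix0.
Qed.
End OrderHomotopy.

Lemma mem_asbool_set (T : finType) (A : set T) x :
  x \in [set y | `[< A y >]]%SET <-> A x.
Proof. by rewrite finset.in_set; split=> /asboolP. Qed.

(** * From invariant open covers to covers by subcomplexes *)

Section CCtoSC.
Context (d : Order.disp_t) (n : nat) (P S : finPOrderType d).
Variables (act : 'S_n -> {omorphism S -> S}) (iota : S -> ppow n P).
Hypothesis actK : forall g, cancel (act g) (act g^-1%g).
Hypothesis n_gt0 : (0 < n)%N.

Lemma fpt0 m (j : 'I_n) : fpt (ord0 : 'I_m.+1) j = None.
Proof. by rewrite /fpt unlift_none. Qed.

Lemma fpt_le m (s t : 'I_m.+1) (j : 'I_n) : ~~ odd s ->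
  (t == s.+1 :> nat) || (s == t.+1 :> nat) ->
  (fpt s j <= fpt t j :> fences n m)%O.
Proof.
move=> so st; apply: connect1.
by apply/existsP; exists j; apply/existsP; exists s; apply/existsP; exists t;
  rewrite !eqxx so.
Qed.

Lemma pexp_homo d' (J : finPOrderType d') (e : pexp J P) a b :
  (a <= b)%O -> (val e a <= val e b)%O.
Proof. by move=> ab; have /forallP/(_ a)/forallP/(_ b)/implyP := valP e;
  apply. Qed.

(** Reading a section at position [t] of every fence gives maps [f t]. At [t = 0] the fences share a
    point, so [f 0] is one invariant map; from [t] to [t + 1] the values are comparable, and an
    order homotopy applies. *)
Lemma CC_poset_contiguous m k : CC_poset act iota m k ->
  exists Q : 'I_k -> {set S}, (forall x, exists i, x \in Q i) /\
  forall i, [/\ forall x y, x \in Q i -> (y <= x)%O -> y \in Q i,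
    forall g x, x \in Q i -> act g x \in Q i &
    sym_contiguous (fun g => act g) (chains_in (Q i)) (chains P)
      (fun j v => tnth (iota v) j)].
Proof.
move=> [Q [s [Q_cover QP]]]; exists (fun i => [set x | `[< Q i x >]]%SET);
  split.
  move=> x; have [i _ Qix] : (\bigcup_i Q i) x by rewrite Q_cover.
  by exists i; exact/mem_asbool_set.
move=> i; have [oQ Q_inv s_cont s_equiv s_end] := QP i.
have s_homo := (within_downset_continuous (s i) oQ).1 s_cont.
have Q_act g x : Q i x -> Q i (act g x) by move=> Qx; rewrite -(Q_inv g);
  exists x.
split=> [x y|g x|].
- by move=> /mem_asbool_set Qx yx; apply/mem_asbool_set; exact: (oQ x y).
- by move=> /mem_asbool_set Qx; exact/mem_asbool_set/Q_act.
set Q' := [set _ | _]%SET.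
have Q'P x : x \in Q' -> Q i x by move/mem_asbool_set.
pose f t (j : 'I_n) v := val (s i v) (fpt (inord t : 'I_m.+1) j).
have f_homo t j : {in Q' &, {homo f t j : x y / (x <= y)%O}}.
  by move=> x y /Q'P Qx /Q'P Qy xy; apply: (forallP (s_homo _ _ Qy xy)).
have f_equiv t (g : 'S_n) j v : v \in Q' -> f t j (act g v) = f t (g j) v.
  by move=> /Q'P Qv; exact: s_equiv.
suff cf t : (t <= m)%N ->
    sym_contiguous (fun g => act g) (chains_in Q') (chains P) (f t).
  have vertexQ := @chains_in_vertex _ S Q'.
  have f_end j v : v \in Q' -> f m j v = tnth (iota v) j.
    move=> /Q'P Qv; rewrite -s_end// /f; congr (val (s i v) (fpt _ j)).
    by apply: val_inj; rewrite /= inordK.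
  have f_end_im j t' : t' \in chains_in Q' ->
      (f m j @: t' = (fun v => tnth (iota v) j) @: t')%SET.
    move=> /vertexQ t'Q; apply: eq_in_imset => v vt; apply: f_end.
    by have := t'Q _ vt; rewrite chains_in1.
  (* [f m] and the coordinates of [iota] agree only on [Q'], so they are joined by one more link. *)
  apply: (sym_contiguous_step vertexQ (cf m (leqnn m))).
  - by move=> j t' t'Q; rewrite -f_end_im//; apply: chains_image t'Q _.
  - move=> g j v; rewrite chains_in1 => vQ; rewrite -!f_end//;
    first exact: f_equiv.
    by apply/mem_asbool_set/Q_act/Q'P.
  - move=> j t' t'Q; rewrite -f_end_im// finset.setUid.
    by apply: chains_image t'Q _.
elim: t => [_|t IH tm]; last first.
  have {}IH := IH (ltnW tm).
  (* Fences go up from even to odd positions and down from odd to even ones. *)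
  have [oddt|event] := boolP (odd t).
    apply: (order_homotopy_down actK (f_homo t) (f_homo t.+1) (f_equiv t)
      (f_equiv t.+1) _ IH) => j v _.
    apply/pexp_homo/fpt_le; rewrite !inordK//= ?ltnS ?(ltnW tm)// ?negbK//.
    by rewrite eqxx orbT.
  apply: (order_homotopy_up actK (f_homo t) (f_homo t.+1) (f_equiv t)
      (f_equiv t.+1) _ IH) => j v _.
  by apply/pexp_homo/fpt_le; rewrite !inordK//= ?ltnS ?(ltnW tm)// eqxx.
pose j0 := Ordinal n_gt0.
have -> : f 0%N = fun _ v => f 0%N j0 v.
  apply/funext => j; apply/funext => v; rewrite /f.
  by rewrite (_ : inord 0 = ord0) ?fpt0//; apply: val_inj; rewrite /= inordK.
apply: sym_contiguous_cst => [t' t'Q|g v]; first by apply: chains_image t'Q _.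
rewrite chains_in1 => vQ; rewrite f_equiv// /f.
by rewrite (_ : inord 0 = ord0) ?fpt0//; apply: val_inj; rewrite /= inordK.
Qed.

(** A chain lies in a down-set as soon as its maximum does, so the chains inside the sets [Q i]
    exhaust all chains. *)
Lemma CC_poset_SC_tower m k :
  CC_poset act iota m k -> SC_tower (poset_tower act iota) k.
Proof.
move=> /CC_poset_contiguous[Q [Q_cover QP]]; exists (fun i => chains_in (Q i)).
split.
  apply/setP => s; apply/bigcupP/idP => [[i _ /chains_inP[]//]|sc].
  have [i Qi] := Q_cover (@max_vertex _ (order_complex S) (exist _ s sc)).
  have [Q_down _ _] := QP i.
  exists i => //; apply/chains_inP; split=> // x xs; apply: Q_down Qi _.
  exact: (@max_vertex_ge _ (order_complex S) (exist _ s sc)).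
move=> i; have [Q_down Q_act Q_cont] := QP i; split=> //.
- split; first by apply/fintype.subsetP => s /chains_inP[].
  move=> s t /chains_inP[sc sQ] ts t0; apply/chains_inP; split.
    exact: chainsS ts t0.
  by move=> x /(fintype.subsetP ts)/sQ.
- move=> g.
  have act_chain h s : s \in chains_in (Q i) -> act h @: s \in chains_in (Q i).
    move=> /chains_inP[sc sQ]; apply/chains_inP; split.
      exact: (order_complex_map_simplicial (act h)).
    by move=> _ /imsetP[x /sQ xQ ->]; exact: Q_act.
  apply/setP => s; apply/imsetP/idP => [[t tQ ->]|sQ]; first exact: act_chain.
  exists (act g^-1%g @: s)%SET; first exact: act_chain.
  rewrite -imset_comp (eq_imset _ (g := id)) ?imset_id// => x /=.
  by rewrite -{1}(invgK g) actK.
Qed.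
End CCtoSC.

(** * From subcomplexes to sections along fences *)

Section ChainMaximum.
Context (d : Order.disp_t) (P : finPOrderType d).

(* [x0] is a junk value, returned when [s] has no greatest element. *)
Definition chain_max (x0 : P) (s : {set P}) : P :=
  odflt x0 [pick x in s | [forall y in s, (y <= x)%O]].

Lemma chain_max_eq x0 (s : {set P}) x :
  x \in s -> (forall y, y \in s -> (y <= x)%O) -> chain_max x0 s = x.
Proof.
move=> xs x_max; rewrite /chain_max; case: pickP => [y /andP[ys /forall_inP]|].
  move=> y_max; apply/le_anti; rewrite x_max//=; exact: y_max.
by move=> /(_ x); rewrite xs; case/negP; apply/forall_inP.
Qed.

Lemma chain_maxP x0 s : s \in chains P ->
  chain_max x0 s \in s /\ forall y, y \in s -> (y <= chain_max x0 s)%O.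
Proof.
move=> sc; pose c : face (order_complex P) := exist _ s sc.
rewrite (@chain_max_eq x0 s (max_vertex c)); first split.
- exact: (max_vertex_in c).
- by move=> y ys; exact: (@max_vertex_ge _ _ c).
- exact: (max_vertex_in c).
- by move=> y ys; exact: (@max_vertex_ge _ _ c).
Qed.

Lemma chain_max_le x0 y0 s t : s \in chains P -> t \in chains P ->
  s \subset t -> (chain_max x0 s <= chain_max y0 t)%O.
Proof.
move=> /(chain_maxP x0)[ms _] /(chain_maxP y0)[_ mt] /fintype.subsetP st.
exact/mt/st.
Qed.
End ChainMaximum.

Lemma pexp_of_homo (d d' : Order.disp_t) (J : finPOrderType d)
    (P : finPOrderType d') (f : J -> P) : {homo f : a b / (a <= b)%O} ->
  exists e : pexp J P, forall a, val e a = f a.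
Proof.
move=> f_homo; pose h : {ffun J -> P} := [ffun a => f a].
have h_exp : [forall a, forall b, (a <= b)%O ==> (h a <= h b)%O].
  apply/forallP => a; apply/forallP => b; apply/implyP => ab.
  by rewrite !ffunE; exact: f_homo.
by exists (exist _ h h_exp) => a; rewrite /= ffunE.
Qed.

Section SCtoCC.
Context (d : Order.disp_t) (n : nat) (P S : finPOrderType d).
Variables (act : 'S_n -> {omorphism S -> S}) (iota : S -> ppow n P).
Hypothesis iota_homo : {homo iota : x y / (x <= y)%O}.

Let sd := face (order_complex S).
Let act_sd g := face_map (order_complex_map (act g)).

(** Inclusions between chains become inequalities of maxima: along a fence because odd positions
    carry unions, and in [x] because a smaller face has smaller images. The length [C] is decoupled
    from [c] so that all members of a cover can share it. *)
Lemma sym_contiguous_fences (L : {set {set S}}) (c C : nat)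
    (phi0 : S -> P) (psi : nat -> 'I_n -> S -> P) :
  @subcomplex _ (order_complex S) L ->
  simplicial L (chains P) phi0 ->
  (forall (g : 'S_n) v, [set v]%SET \in L -> phi0 (act g v) = phi0 v) ->
  (forall j l, (l <= c)%N -> simplicial L (chains P) (psi l j)) ->
  (forall j v, [set v]%SET \in L ->
     psi 0 j v = phi0 v /\ psi c j v = tnth (iota v) j) ->
  (forall j l s, (1 <= l <= c)%N -> s \in L ->
     psi l.-1 j @: s :|: psi l j @: s \in chains P)%SET ->
  (forall (g : 'S_n) j l v, (l <= c)%N -> [set v]%SET \in L ->
     psi l j (act g v) = psi l (g j) v) ->
  (c <= C)%N ->
  exists s : sd -> pexp (fences n C.*2) P,
  [/\ forall x y : sd, val x \in L -> (y <= x)%O -> (s y <= s x)%O,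
      forall g (x : sd), val x \in L -> val (act_sd g x) \in L -> forall t j,
        val (s (act_sd g x)) (fpt t j) = val (s x) (fpt t (g j)) &
      forall x : sd, val x \in L ->
        forall j, val (s x) (fpt ord_max j) = tnth (iota (max_vertex x)) j].
Proof.
move=> subL sphi0 iphi0 spsi epsi cpsi ipsi cC.
have vertexL := subcomplex_vertex subL.
(* Time stops at [c]; the fence rests at its end point up to position [2C]. *)
pose psi' l := psi (minn l c).
(* For even [t] the two halves coincide and one image remains; odd [t] gives the union of two
   consecutive images. *)
pose U t j (x : sd) :=
  (psi' t./2 j @: val x :|: psi' (uphalf t) j @: val x)%SET.
pose x0 (x : sd) := phi0 (max_vertex x).
(* The centre belongs to no particular leg, so its value is taken from [phi0], which [U 0] matches
   on [L]. *)
pose value (x : sd) (a : fences n C.*2) := chain_max (x0 x)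
  (if a is Some (j, t) then U t.+1 j x else phi0 @: val x)%SET.
have U0 j (x : sd) : val x \in L -> U 0%N j x = (phi0 @: val x)%SET.
  move=> xL; rewrite /U /psi' min0n finset.setUid.
  by apply: eq_in_imset => v /(vertexL _ _ xL)/(epsi j)[].
have valueE (x : sd) t j : val x \in L ->
  value x (fpt t j) = chain_max (x0 x) (U t j x).
  move=> xL; rewrite /value /fpt; case: unliftP => [t' ->//|->].
  by rewrite [in RHS]U0.
have U_chain t j (x : sd) : val x \in L -> U t j x \in chains P.
  move=> xL; rewrite /U uphalf_half.
  have [ct|tc] := leqP c t./2.
    rewrite /psi' (minn_idPr ct).
    have -> : minn (odd t + t./2)%N c = c.
      exact/minn_idPr/(leq_trans ct)/leq_addl.
    by rewrite finset.setUid; exact: spsi.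
  rewrite /psi' (minn_idPl (ltnW tc)).
  case: (odd t) => /=; last by rewrite add0n (minn_idPl (ltnW tc))
    finset.setUid;
    exact: spsi (ltnW tc) _ xL.
  by rewrite add1n (minn_idPl tc); exact: (cpsi j t./2.+1).
have value_homo (x : sd) a b : val x \in L -> (a <= b)%O ->
  (value x a <= value x b)%O.
  move=> xL; rewrite [(_ <= _)%O]fence_leE => /predU1P[->//|].
  move=> /existsP[j] /existsP[s] /existsP[t] /and4P[/eqP-> /eqP-> so st].
  rewrite !valueE//; apply: chain_max_le; [exact: U_chain|exact: U_chain|].
  rewrite /U uphalf_half (negPf so) add0n finset.setUid uphalf_half.
  case/orP: st => /eqP st.
    by rewrite st /= uphalf_half (negPf so) add0n; exact: finset.subsetUl.
  move: so; rewrite st /= negbK uphalf_half => ->; exact: finset.subsetUr.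
have value_exp (x : sd) : exists e : pexp (fences n C.*2) P,
    val x \in L -> forall a, val e a = value x a.
  have [xL|xL] := boolP (val x \in L); last first.
    by have [e _] := @pexp_of_homo _ _ (fences n C.*2) _ (fun=> x0 x)
      (fun _ _ _ => lexx _); exists e.
  have [e eE] := @pexp_of_homo _ _ (fences n C.*2) _ (value x)
    (fun a b => @value_homo x a b xL).
  by exists e => _ a; exact: eE.
have [s sE] := choice value_exp.
have down (x y : sd) : val x \in L -> (y <= x)%O -> val y \in L.
  move=> xL yx; have [_ sub_closed] := subL.
  apply: sub_closed xL yx _; exact: simp_neq0 (valP y).
exists s; split.
- move=> x y xL yx; have yL := down _ _ xL yx.
  apply/forallP => a; rewrite !sE// /value.
  have sub_im (f : S -> P) : (f @: val y \subset f @: val x)%SET by exact: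
    imsetS.
  case: a => [[j t]|].
    apply: chain_max_le; [exact: U_chain|exact: U_chain|].
    by apply: finset.setUSS.
  by apply: chain_max_le => //; exact: sphi0.
- move=> g x xL gxL t j; rewrite !sE// !valueE//.
  suff -> : U t j (act_sd g x) = U t (g j) x.
    (* The two sides carry different junk values, hence two inequalities in place of a rewriting. *)
    by apply/le_anti/andP; split; apply: chain_max_le => //; exact: U_chain.
  rewrite /U /=; congr (_ :|: _)%SET; rewrite -imset_comp;
    by apply: eq_in_imset => v vx; apply: ipsi; rewrite ?geq_minr//;
      exact: vertexL vx.
- move=> x xL j; rewrite sE// valueE//.
  have -> : U (ord_max : 'I_(C.*2).+1) j x = ((fun v =>
    tnth (iota v) j) @: val x)%SET.
    rewrite /U /= doubleK uphalf_half odd_double add0n doubleK finset.setUid.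
    rewrite /psi' (minn_idPr cC).
    by apply: eq_in_imset => v /(vertexL _ _ xL)/(epsi j)[].
  (* [iota] is monotone, so the maximum of the image of [x] is attained at the largest vertex of
     [x]. *)
  apply: chain_max_eq.
    by apply/imsetP; exists (max_vertex x) => //; exact: max_vertex_in.
  move=> _ /imsetP[v vx ->].
  have := iota_homo (max_vertex_ge vx).
  by rewrite Order.TupleProdOrder.leEtprod => /forallP.
Qed.

Lemma SC_tower_CC_poset k : SC_tower (poset_tower act iota) k ->
  exists m, CC_poset (S := sd) act_sd (fun x : sd => iota (max_vertex x)) m k.
Proof.
move=> [L [L_cover LP]].
have contL i : exists c, forall C, (c <= C)%N ->
    exists s : sd -> pexp (fences n C.*2) P,
  [/\ forall x y : sd, val x \in L i -> (y <= x)%O -> (s y <= s x)%O,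
      forall g (x : sd), val x \in L i -> val (act_sd g x) \in L i ->
        forall t j,
        val (s (act_sd g x)) (fpt t j) = val (s x) (fpt t (g j)) &
      forall x : sd, val x \in L i ->
        forall j, val (s x) (fpt ord_max j) = tnth (iota (max_vertex x)) j].
  have [subL _ [phi0 [c [psi [[? ?] ? ? ? [? ?]]]]]] := LP i.
  by exists c => C cC; apply: (@sym_contiguous_fences _ c C phi0 psi).
have [c cP] := choice contL; pose C := (\max_i c i)%N.
have [s sP] := choice (fun i => cP i C (leq_bigmax i)).
have L_act i g x : val x \in L i -> val (act_sd g x) \in L i.
  by move=> xL; have [_ L_inv _] := LP i; rewrite -(L_inv g); exact: imset_f.
exists C.*2, (fun i => [set x | val x \in L i]), s; split.
  apply/seteqP; split=> // x _.
  have /bigcupP[i _ xL] : val x \in (\bigcup_i L i)%SET by rewrite L_cover;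
    exact: valP.
  by exists i.
move=> i; have [s_homo s_equiv s_end] := sP i; have [subL L_inv _] := LP i.
have oQ : open ([set x | val x \in L i] : set (downset_space sd)).
  move=> x y yx /= xL; have [_ sub_closed] := subL.
  by apply: sub_closed xL yx _; exact: simp_neq0 (valP y).
split=> //.
- move=> g; apply/seteqP; split=> [_ [x /= xL <-]|x /= xL]; first exact: L_act.
  have : val x \in [set act g @: (s : {set _}) | s in L i]%SET by rewrite L_inv.
  move=> /imsetP[t tL xE]; have tS : t \in simp (order_complex S).
    by have [/fintype.subsetP + _] := subL; apply.
  by exists (exist _ t tS) => //; apply: val_inj.
- by apply/within_downset_continuous.
- by move=> g x xL; apply: s_equiv => //; exact: L_act.
Qed.
End SCtoCC.

Section CombinatorialSimplicial.
Context (R : realType) (d : Order.disp_t) (n : nat) (P : finPOrderType d).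
Hypothesis n_gt0 : (0 < n)%N.
Variable a : sym_approximations R n (order_complex P).

(** The given approximations are exchanged for those by largest vertices, whose composites are the
    maps [tau_iter]. *)
Lemma SC_cover_tower r k :
  SC_cover a r k <-> SC_tower (poset_tower
    (fun g : 'S_n => sdp_map (@pperm d n P g) r) (@tau_iter _ _ r)) k.
Proof.
rewrite -tower_sdc_sdp; pose b := max_approximations n (order_complex P) R.
split=> [/(@SC_cover_indep _ _ _ _ _ b)//|].
exact: (@SC_cover_indep _ _ _ _ b a).
Qed.

Lemma sdp_ppermK r (g : 'S_n) : cancel (sdp_map (@pperm d n P g) r)
  (sdp_map (@pperm d n P g^-1%g) r).
Proof. exact/sdp_mapK/ppermK. Qed.

Lemma CC_cover_SC_cover r m k : CC_cover n P r m k -> SC_cover a r k.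
Proof. by move=> cc; apply/SC_cover_tower/(CC_poset_SC_tower _ _
  cc)/n_gt0/sdp_ppermK. Qed.

Lemma SC_cover_CC_cover r k :
  SC_cover a r k -> exists m, CC_cover n P r.+1 m k.
Proof. by move=> /SC_cover_tower/SC_tower_CC_poset; apply;
  exact: tau_iter_homo. Qed.
End CombinatorialSimplicial.

(** * Topology of realizations *)

Lemma ptws_cvg (I : Type) (T : topologicalType) (F : set_system {ptws I -> T})
    (f : {ptws I -> T}) : Filter F ->
  (forall i, (fun g : {ptws I -> T} => g i) @ F --> f i) -> F --> f.
Proof.
move=> FF cvF; apply/cvg_sup => i A [_ [[B oB <-] Bf BA]].
by apply: filterS BA _; apply: cvF; exact: open_nbhs_nbhs.
Qed.

Lemma set_type_cvg (T : topologicalType) (A : set T) (F : set_system (set_type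
  A))
    (x : set_type A) : Filter F ->
  set_val @ F --> (set_val x : T) -> F --> x.
Proof.
move=> FF cvF B [_ [[C oC <-] Cx CB]].
by apply: filterS CB _; apply: cvF; exact: open_nbhs_nbhs.
Qed.

Lemma set_val_continuous (T : topologicalType) (A : set T) :
  continuous (set_val : set_type A -> T).
Proof. exact: initial_continuous. Qed.

Lemma ptws_proj_continuous (I : eqType) (T : topologicalType) (i : I) :
  continuous (fun f : {ptws I -> T} => f i).
Proof. exact: (@proj_continuous _ (fun=> T)). Qed.

Lemma set_type_compact (T : topologicalType) (A : set T) :
  compact A -> compact [set: set_type A].
Proof.
move=> cA F PF _.
have FA : F (set_val @^-1` A).
  by rewrite (_ : _ @^-1` _ = setT); [exact: filterT|apply/seteqP;
    split=> // x _; exact: set_valP].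
have [x [Ax clx]] := cA (set_val @ F) (fmap_proper_filter _ PF) FA.
exists (SigSub (mem_set Ax)); split=> // B C FB [_ [[D oD <-] Dx DC]].
have FB' : F (set_val @^-1` (set_val @` B)).
  by apply: filterS FB => z Bz; exists z.
have [y [[z Bz zE] Dy]] := clx _ D FB' (open_nbhs_nbhs (conj oD Dx)).
by exists z; split => //; apply: DC => /=; rewrite zE.
Qed.

Lemma continuous_pair (T U V : topologicalType) (f : T -> U) (g : T -> V) x :
  {for x, continuous f} -> {for x, continuous g} ->
  {for x, continuous (fun t => (f t, g t))}.
Proof. by move=> fx gx; exact: cvg_pair. Qed.

Section FiniteOperations.
Context (R : realType) (T : topologicalType) (x : T).

Lemma continuous_sum (I : Type) (r : seq I) (p : pred I) (f : I -> T -> R) :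
  (forall i, p i -> {for x, continuous (f i)}) ->
  {for x, continuous (fun y => \sum_(i <- r | p i) f i y)}.
Proof.
move=> fc; elim: r => [|i r IH].
  rewrite (_ : (fun _ => _) = fun=> 0); first exact: cvg_cst.
  by apply/funext => y; rewrite big_nil.
case pi: (p i).
  rewrite (_ : (fun _ => _) = fun y => f i y + \sum_(i <- r | p i) f i y).
    by apply: continuousD; [exact: fc|exact: IH].
  by apply/funext => y; rewrite big_cons pi.
rewrite (_ : (fun _ => _) = fun y => \sum_(i <- r | p i) f i y)//.
by apply/funext => y; rewrite big_cons pi.
Qed.

Lemma continuous_prod (I : Type) (r : seq I) (p : pred I) (f : I -> T -> R) :
  (forall i, p i -> {for x, continuous (f i)}) ->
  {for x, continuous (fun y => \prod_(i <- r | p i) f i y)}.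
Proof.
move=> fc; elim: r => [|i r IH].
  rewrite (_ : (fun _ => _) = fun=> 1); first exact: cvg_cst.
  by apply/funext => y; rewrite big_nil.
case pi: (p i).
  rewrite (_ : (fun _ => _) = fun y => f i y * \prod_(i <- r | p i) f i y).
    by apply: continuousM; [exact: fc|exact: IH].
  by apply/funext => y; rewrite big_cons pi.
rewrite (_ : (fun _ => _) = fun y => \prod_(i <- r | p i) f i y)//.
by apply/funext => y; rewrite big_cons pi.
Qed.
End FiniteOperations.

Section SupDistance.
Context (R : realType) (V : Type).
Implicit Types x y z : V -> R.

Definition sup_close (e : R) x y : Prop := forall v, `|x v - y v| < e.

Lemma sup_closeC e x y : sup_close e x y -> sup_close e y x.
Proof. by move=> xy v; rewrite distrC. Qed.

Lemma sup_close_trans e e' x y z :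
  sup_close e x y -> sup_close e' y z -> sup_close (e + e') x z.
Proof.
move=> xy yz v; apply: le_lt_trans (ltrD (xy v) (yz v)).
by rewrite -[X in `|X|](subrKA (y v)) ler_normD.
Qed.
End SupDistance.

Section RealizationTopology.
Context (R : realType) (d : Order.disp_t) (M : ocomplex d).

Definition bcoord (x : realization R M) : M -> R := set_val x.

Lemma bcoord_geom (x : realization R M) : geom (bcoord x).
Proof. exact: set_valP. Qed.

Lemma bcoord_continuous v : continuous (fun x => bcoord x v).
Proof.
move=> x; apply: (@continuous_comp _ _ _ set_val (fun f : {ptws M ->
  R} => f v)).
  exact: set_val_continuous.
exact: ptws_proj_continuous.
Qed.

Lemma realization_cvg (T : Type) (F : set_system T) (f : T ->
  realization R M) x :
  Filter F -> (forall v, bcoord (f t) v @[t --> F] --> bcoord x v) ->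
  f @ F --> x.
Proof.
move=> FF fc; apply: set_type_cvg; apply: ptws_cvg => v; exact: fc.
Qed.

(** The sup-neighbourhoods of [x] generate a filter that converges to [x] coordinate by coordinate,
    hence is finer than the neighbourhood filter. *)
Lemma near_close (x : realization R M) (A : set (realization R M)) :
  nbhs x A -> \forall e \near (0 : R)^'+,
    forall y, sup_close e (bcoord x) (bcoord y) -> A y.
Proof.
pose F : set_system (realization R M) :=
  [set B | exists2 e : R, 0 < e & forall y,
    sup_close e (bcoord x) (bcoord y) -> B y].
have FF : Filter F.
  split.
  - by exists 1.
  - move=> B C [e e0 eB] [e' e'0 e'C]; exists (Num.min e e').
      by rewrite lt_min e0.
    move=> y ye; split; [apply: eB|apply: e'C] => v;
      by have := ye v; rewrite lt_min => /andP[].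
  - by move=> B C BC [e e0 eB]; exists e => // y /eB/BC.
have /[apply] : F --> x.
  apply: (@realization_cvg _ F id) => v; apply/cvgrPdist_lt => e e0.
  by exists e => // y; exact.
move=> [e e0 eA]; near=> e' => y ye'; apply: eA => v;
  apply: lt_le_trans (ye' v) _.
near: e'; exact: nbhs_right_le.
Unshelve. all: by end_near. Qed.

(** Coordinates that are positive at [x] remain positive nearby, so the support of [x] is contained
    in that of some point of the realization, hence in a simplex. *)
Lemma geom_closed : closed (@geom R d M).
Proof.
move=> x clx.
have near_ex (A : set {ptws M -> R}) : nbhs x A -> exists2 y, geom y & A y.
  by move=> /clx[y [gy Ay]]; exists y.
have xv (v : M) : (fun y : {ptws M -> R} => y v) @ x --> x v.
  exact: ptws_proj_continuous.
have x_ge0 v : 0 <= x v.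
  rewrite leNgt; apply/negP => xv0.
  have [y [y0 _ _]] := near_ex _ (cvgr_lt _ (xv v) _ xv0).
  by rewrite /= ltNge y0.
have x_sum : \sum_v x v = 1.
  apply/eqP; have [//|x1] := boolP (_ == _).
  have xs : (fun y : {ptws M -> R} => \sum_v y v) @ x --> \sum_v x v.
    by apply: continuous_sum => v _; exact: ptws_proj_continuous.
  move: x1; rewrite neq_lt => /orP[] x1'.
    by have [y [_ -> _] /=] := near_ex _ (cvgr_lt _ xs _ x1'); rewrite ltxx.
  by have [y [_ -> _] /=] := near_ex _ (cvgr_gt _ xs _ x1'); rewrite ltxx.
split=> //; pose s := [set v | x v != 0]%SET; exists s; last by move=> v;
  rewrite inE.
have sE v : (v \in s) = (x v != 0) by rewrite finset.in_set.
have s_pos v : nbhs (x : {ptws M -> R}) [set y | v \in s -> 0 < y v].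
  have [xv0|xv0] := eqVneq (x v) 0.
    have -> : [set y : {ptws M -> R} | v \in s -> 0 < y v] = setT.
      by apply/seteqP; split=> // y _ /=; rewrite sE xv0 eqxx.
    exact: (@filterT _ _ (nbhs_filter (x : {ptws M -> R}))).
  have xv_gt0 : 0 < x v by rewrite lt_neqAle eq_sym xv0 x_ge0.
  by apply: filterS (cvgr_gt _ (xv v) _ xv_gt0) => y yv _.
have : nbhs (x : {ptws M -> R}) [set y | forall v, v \in s -> 0 < y v].
  exact: (filter_forall (nbhs_filter (x : {ptws M -> R})) s_pos).
move=> /near_ex[y [_ _ [t tM yt]] y_pos].
have : s != finset.set0.
  apply/eqP => s0; move: x_sum; rewrite big1 => [/eqP|v _].
    by rewrite eq_sym oner_eq0.
  by apply/eqP; have := sE v; rewrite s0 finset.inE => /esym/negbFE.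
apply: (simpS tM); apply/fintype.subsetP => v /y_pos yv.
by apply: yt; rewrite gt_eqF.
Qed.

Lemma geom_compact : compact (@geom R d M).
Proof.
have box : compact [set x : {ptws M ->
  R} | forall v, (`[0, 1]%classic : set R) (x v)].
  by apply: (@tychonoff M (fun=> R) (fun=> `[0, 1]%classic)) => v;
    exact: segment_compact.
apply: subclosed_compact geom_closed box _ => x [x_ge0 x1 _] v /=.
rewrite in_itv /= x_ge0 -x1 (bigD1 v)//= lerDl.
by apply: sumr_ge0 => u _.
Qed.

Lemma realization_compact : compact [set: realization R M].
Proof. exact/set_type_compact/geom_compact. Qed.
End RealizationTopology.

Section UnitInterval.
Context (R : realType).

Lemma unit_interval_compact : compact [set: unit_interval R].
Proof.
apply: set_type_compact; rewrite (_ : mkset _ = `[0, 1]%classic).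
  exact: segment_compact.
by apply/seteqP; split=> t; rewrite /= in_itv.
Qed.

Lemma near_close_unit_interval (t : unit_interval R) (A : set (unit_interval
  R)) :
  nbhs t A -> \forall e \near (0 : R)^'+,
    forall u, `|set_val t - set_val u : R| < e -> A u.
Proof.
move=> [_ [[B oB <-] Bt BA]].
have : nbhs (set_val t : R) B by exact: open_nbhs_nbhs.
move=> /nbhs_ballP[e /= e0 eB]; near=> e' => u tu; apply/BA/eB.
by apply: lt_le_trans tu _; near: e'; exact: nbhs_right_le.
Unshelve. all: by end_near. Qed.

Lemma ui0_closed : closed [set ui0 R].
Proof.
rewrite (_ : [set _] = set_val @^-1` [set 0]).
  apply: preimage_closed => [t _|]; first exact: set_val_continuous.
  exact/accessible_closed_set1/hausdorff_accessible/norm_hausdorff.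
by apply/seteqP; split=> [_ -> //|t /= t0]; exact: val_inj.
Qed.
End UnitInterval.

(** * Families of paths *)

Section StarMaps.
Context (R : realType) (n : nat) (X T : topologicalType).
Implicit Types (s : T -> star_maps R n X) (y : T) (t : unit_interval R).

Lemma spt_continuous j : continuous (fun t => spt (n := n) t j).
Proof. exact: (@wedge_lift_continuous _ _ (fun _ : 'I_n => ui0 R) j). Qed.

Lemma star_map_continuous (f : star_maps R n X) :
  continuous (set_val f : star R n -> X).
Proof. exact: (set_valP f). Qed.

(** The interval is locally compact: a compact neighbourhood [D] of [t] that the leg [j] of [s y]
    maps into [B] yields a compact-open neighbourhood of [s y]. *)
Lemma star_maps_eval s y t j : {for y, continuous s} ->
  set_val (s z.1) (spt z.2 j) @[z --> (y, t)] --> set_val (s y) (spt t j).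
Proof.
move=> sy A; rewrite nbhsE => -[B [oB Bst] BA].
have ctsy : continuous (fun u => set_val (s y) (spt u j)).
  move=> u; apply: (@continuous_comp _ _ _ (fun u => spt u j)).
    exact: spt_continuous.
  exact: star_map_continuous.
have : nbhs t [set u | B (set_val (s y) (spt u j))].
  by apply: ctsy; exact: open_nbhs_nbhs.
move=> /near_close_unit_interval[e /= e0 eB].
have e20 : 0 < e / 2 by rewrite divr_gt0.
pose D : set (unit_interval R) :=
  [set u | `|set_val t - set_val u : R| <= e / 4].
have cD : compact D.
  apply: (subclosed_compact _ (@unit_interval_compact R)) => //.
  rewrite (_ : D = set_val @^-1` (closed_ball_ Num.norm (set_val t : R) (e /
    4)))//.
  apply: preimage_closed => [u _|]; first exact: set_val_continuous.
  exact: closed_closed_ball_.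
have eD : D `<=` [set u | B (set_val (s y) (spt u j))].
  move=> u /= ue; apply: (eB (e / 2)) => //=.
    by rewrite sub0r normrN gtr0_norm// ltr_pdivrMr// ltr_pMr// ltr1n.
  apply: le_lt_trans ue _; rewrite ltr_pM2l// ltf_pV2 ?posrE// ltr_nat.
  by [].
have cimD : compact ((fun u => spt (n := n) u j) @` D).
  apply: continuous_compact => //.
  exact/continuous_subspaceT/spt_continuous.
have sBD : \forall y' \near y,
    set_val (s y') @` ((fun u => spt u j) @` D) `<=` B.
  have sy' : (fun y' => (set_val (s y') : {compact-open, star R n ->
    X})) @ y -->
      (set_val (s y) : {compact-open, star R n -> X}).
    apply: (@continuous_comp _ _ _ s set_val) => //.
    exact: (@set_val_continuous {compact-open, star R n -> X}).
  move/compact_open_cvgP : sy' => /(_ ((fun u => spt u j) @` D) B cimD oB).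
  by apply => _ [_ [u /eD Bu <-] <-].
have tD : nbhs t D.
  have : nbhs (set_val t : R) (ball (set_val t : R) (e / 4)).
    by apply: nbhsx_ballx; rewrite divr_gt0.
  move=> /(@set_val_continuous _ _ t) nt.
  by apply: (@filterS _ (nbhs t) _ _ _ _ nt) => u /= tu; exact: ltW.
exists ([set y' | set_val (s y') @` ((fun u => spt u j) @` D) `<=` B], D) => //.
move=> [y' u] [/= y'B Du]; apply/BA/y'B.
by exists (spt u j) => //; exists u.
Qed.

(** Compactness of [C] reduces the claim to a neighbourhood of each point of the star. Inside a leg,
    joint continuity is enough; at the centre, neighbourhoods in the finitely many legs are
    combined. *)
Lemma star_maps_cvg s y :
  (forall j t, set_val (s z.1) (spt z.2 j) @[z --> (y, t)] -->
     set_val (s y) (spt t j)) ->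
  {for y, continuous s}.
Proof.
move=> s_joint; apply: set_type_cvg; apply/compact_open_cvgP => C O cC oO sCO.
have /compact_near_coveringP/(_ _ (nbhs y)
  (fun y' p => O (set_val (s y') p))) := cC.
move=> /(_ _) cover.
suff : \forall y' \near y, C `<=` [set p | O (set_val (s y') p)].
  by apply: filterS => y' CO _ [p /CO Op <-].
apply: cover => p Cp.
have Op : O (set_val (s y) p) by apply: sCO; exists p.
have leg j t : O (set_val (s y) (spt t j)) ->
    exists A B, [/\ nbhs y A, nbhs t B &
      forall y' t', A y' -> B t' -> O (set_val (s y') (spt t' j))].
  move=> Ot; have : nbhs (set_val (s y) (spt t j)) O by exact: open_nbhs_nbhs.
  move=> /(s_joint j t)[[A B] [/= Ay Bt AB]]; exists A, B;
    split=> // y' t' Ay' Bt'.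
  exact: (AB (y', t')).
have ui0c (i : 'I_n) : closed [set ui0 R] by exact: ui0_closed.
have := Op.
case: (wedge_nbhs_specP p ui0c) => [i0 Op0|j t tN0 Op0]; last first.
  have [A [B [Ay Bt AB]]] := leg j t Op0.
  exists ((@wedge_lift _ _ (fun _ : 'I_n => ui0 R) j) @` B, A).
    split=> //=.
    rewrite -(wedge_lift_nbhs (p0 := fun _ : 'I_n => ui0 R) (ui0c j) tN0).
    by apply: (@filterS _ (nbhs t) _ _ _ _ Bt) => t' Bt'; exists t'.
  by move=> [q y'] /= [[t' Bt' <-] Ay']; exact: AB.
have {}leg j : exists AB : set T * set (unit_interval R),
    [/\ nbhs y AB.1, nbhs (ui0 R) AB.2 &
      forall y' t', AB.1 y' -> AB.2 t' -> O (set_val (s y') (spt t' j))].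
  have [|A [B [Ay Bt AB]]] := leg j (ui0 R); last by exists (A, B).
  by rewrite /spt (@wedge_liftE _ _ (fun _ : 'I_n =>
    ui0 R) i0 (ui0 R) j (ui0 R)).
have [AB ABP] := choice leg.
exists ([set q | exists j t', (AB j).2 t' /\ q = spt t' j],
  [set y' | forall j, (AB j).1 y']).
  split; last by apply: filter_forall => j; have [] := ABP j.
  rewrite (wedge_point_nbhs (fun _ : 'I_n => ui0 R) i0).
  by move=> j _; have [_ + _] := ABP j; move=> nAB;
    apply: (@filterS _ (nbhs (ui0 R)) _ _ _ _ nAB) => t' ABt'; exists j, t'.
by move=> [q y'] /= [[j [t' [ABt' ->]]] ABy']; have [_ _] := ABP j; apply.
Qed.
End StarMaps.

(** * From combinatorial to topological complexity *)

Section Normalization.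
Context (R : realType).

Definition pos (r : R) : R := Num.max 0 r.

Lemma pos_ge0 r : 0 <= pos r. Proof. by rewrite le_max lexx. Qed.

Lemma pos_neq0 r : (pos r != 0) = (0 < r).
Proof. by rewrite /pos; case: ltrP => [/gt_eqF->|]; rewrite ?eqxx. Qed.

Lemma pos_continuous (T : topologicalType) (f : T -> R) x :
  {for x, continuous f} -> {for x, continuous (fun y => pos (f y))}.
Proof.
move=> fx; rewrite (_ : (fun _ => _) = (fun=> 0) \max f)//.
by apply: continuous_max => //; exact: cvg_cst.
Qed.

Definition normalize (V : finType) (w : V -> R) (v : V) : R := w v / \sum_u w u.

Lemma sumr_gt0_neq0 (V : finType) (w : V -> R) : (forall v, 0 <= w v) ->
  (exists v, w v != 0) -> 0 < \sum_v w v.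
Proof.
move=> w_ge0 [v wv]; rewrite (bigD1 v)//= ltr_wpDr ?sumr_ge0//.
by rewrite lt_neqAle eq_sym wv w_ge0.
Qed.

Lemma normalize_neq0 (V : finType) (w : V -> R) v :
  normalize w v != 0 -> w v != 0.
Proof. by apply: contraNN => /eqP w0; rewrite /normalize w0 mul0r. Qed.

Lemma normalize_geom (d : Order.disp_t) (M : ocomplex d) (w : M -> R) :
  (forall v, 0 <= w v) -> (exists v, w v != 0) ->
  (exists2 s, s \in simp M & support_in s w) -> geom (normalize w).
Proof.
move=> w_ge0 w_neq0 [s sM ws]; have sum_gt0 := sumr_gt0_neq0 w_ge0 w_neq0.
split=> [v||]; first by rewrite divr_ge0// ltW.
  by rewrite -mulr_suml divff// gt_eqF.
by exists s => // v /normalize_neq0; exact: ws.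
Qed.

Lemma normalize_bij (V : finType) (h : V -> V) (w w' : V ->
  R) v : bijective h ->
  (forall u, w' (h u) = w u) -> normalize w' (h v) = normalize w v.
Proof.
move=> h_bij ww'; rewrite /normalize ww'; congr (_ / _).
by rewrite (reindex h) /=; [exact: eq_bigr|exact: onW_bij].
Qed.

Lemma normalize_continuous (T : topologicalType) (V : finType)
    (w : T -> V -> R) x v :
  (forall u, {for x, continuous (fun y => w y u)}) -> \sum_u w x u != 0 ->
  {for x, continuous (fun y => normalize (w y) v)}.
Proof.
move=> w_cont sum_neq0; apply: continuousM; first exact: w_cont.
by apply: continuousV => //; apply: continuous_sum => u _; exact: w_cont.
Qed.
End Normalization.

Lemma chains_neq0_support (R : realType) (d : Order.disp_t) (S : finPOrderType
  d)
    (w : S -> R) : (exists v, w v != 0) ->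
  (forall u v, w u != 0 -> w v != 0 -> (u >=< v)%O) ->
  exists2 s, s \in chains S & support_in s w.
Proof.
move=> [v wv] w_chain; exists [set u | w u != 0]%SET; last first.
  by move=> u; rewrite inE.
apply/chainsP; split; first by apply/set0Pn; exists v; rewrite inE.
by move=> x y; rewrite !inE; exact: w_chain.
Qed.

Lemma geom_comparable (R : realType) (d : Order.disp_t) (S : finPOrderType d)
    (w : S -> R) u v : @geom R d (order_complex S) w ->
  w u != 0 -> w v != 0 -> (u >=< v)%O.
Proof. by move=> [_ _ [s /chainsP[_ s_total] ws]] /ws us /ws;
  exact: s_total. Qed.

Lemma geom_neq0 (R : realType) (d : Order.disp_t) (M : ocomplex d) (w : M ->
  R) :
  geom w -> exists v, w v != 0.
Proof.
move=> [_ w1 _]; apply: contrapT => w0; move: w1; rewrite big1.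
  by move/esym/eqP; rewrite oner_eq0.
by move=> v _; apply/eqP; apply: contrapT => wv; apply: w0; exists v;
  exact/negP.
Qed.

(* A point [(y_1, .., y_n)] of [|K(P)|^n] is a tuple of probability measures on
   [P], each supported by a chain, with distribution functions [F_1, .., F_n].
   The point [v] of [P^n] gets a positive weight when the quantile intervals
   [(F_j^-(v_j), F_j(v_j))] have a common point; such [v] form a chain. *)
Section Coupling.
Context (R : realType) (d : Order.disp_t) (n : nat) (P : finPOrderType d).

Definition cdf (x : P -> R) v : R := \sum_(u | (u <= v)%O) x u.
Definition lcdf (x : P -> R) v : R := \sum_(u | (u < v)%O) x u.

Lemma cdf_lcdf x v : cdf x v = lcdf x v + x v.
Proof.
rewrite /cdf (bigD1 v)//= addrC; congr (_ + _); apply: eq_bigl => u.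
by rewrite lt_neqAle andbC.
Qed.

Lemma cdf_le_lcdf x u v : (forall w, 0 <= x w) -> (u < v)%O ->
  cdf x u <= lcdf x v.
Proof.
move=> x_ge0 uv; rewrite /cdf /lcdf [leRHS](bigID (fun w => (w <= u)%O))/=.
rewrite (eq_bigl (fun w => (w < v)%O && (w <= u)%O)) ?lerDl ?sumr_ge0// => w.
by apply/idP/andP => [wu|[]//]; split=> //; exact: le_lt_trans uv.
Qed.

Definition coupling (y : 'I_n -> P -> R) (v : ppow n P) : R :=
  \prod_(p : 'I_n * 'I_n)
    pos (cdf (y p.1) (tnth v p.1) - lcdf (y p.2) (tnth v p.2)).

Variable y : 'I_n -> P -> R.
Hypothesis y_geom : forall j, @geom R d (order_complex P) (y j).

Let y_ge0 j v : 0 <= y j v. Proof. by have [] := y_geom j. Qed.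

Lemma coupling_ge0 v : 0 <= coupling y v.
Proof. by apply: prodr_ge0 => p _; exact: pos_ge0. Qed.

Lemma coupling_neq0 v : (coupling y v != 0) =
  [forall p : 'I_n * 'I_n,
    lcdf (y p.2) (tnth v p.2) < cdf (y p.1) (tnth v p.1)].
Proof.
apply/prodf_neq0/forallP => [lt p|lt p _].
  by have := lt p isT; rewrite pos_neq0 subr_gt0.
by rewrite pos_neq0 subr_gt0.
Qed.

(** The factor indexed by [(j, j)] is the positive part of the mass [y j (tnth v j)]. *)
Lemma coupling_support v j : coupling y v != 0 -> y j (tnth v j) != 0.
Proof.
rewrite coupling_neq0 => /forallP/(_ (j, j)) /=; rewrite cdf_lcdf ltrDl.
by move=> /gt_eqF->.
Qed.

(** If [v_i < u_i] and [u_j < v_j], then [F_i(v_i) <= F_i^-(u_i) < F_j(u_j) <= F_j^-(v_j) <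
    F_i(v_i)], which is absurd. *)
Lemma coupling_chain u v : coupling y u != 0 -> coupling y v != 0 ->
  (u >=< v)%O.
Proof.
move=> cu cv; apply: contrapT; move/negP; rewrite negb_or => /andP[].
rewrite !Order.TupleProdOrder.leEtprod => /forallPn[i nuv] /forallPn[j nvu].
have comp k := geom_comparable (y_geom k) (coupling_support k cu)
  (coupling_support k cv).
have vui : (tnth v i < tnth u i)%O.
  by have := comp i; rewrite comparable_sym => /comparable_ltNge->.
have uvj : (tnth u j < tnth v j)%O by have := comp j => /comparable_ltNge->.
move: cu cv; rewrite !coupling_neq0 =>
  /forallP/(_ (j, i))/= cu /forallP/(_ (i, j))/= cv.
have := lt_trans (le_lt_trans (cdf_le_lcdf (y_ge0 i) vui) cu)
  (le_lt_trans (cdf_le_lcdf (y_ge0 j) uvj) cv).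
by rewrite ltxx.
Qed.

Lemma coupling_ex : exists v, coupling y v != 0.
Proof.
have min_support j : exists v, y j v != 0 /\ lcdf (y j) v = 0.
  have [v0 v0P] := geom_neq0 (y_geom j).
  (* A point of least rank in the support has no mass strictly below it, so its quantile interval
     starts at 0; such intervals, one for each [j], have a common point. *)
  have [v v_neq0 v_min] := 
    @arg_minnP P v0 (fun v => y j v != 0) (fun v => rank v) v0P.
  exists v; split=> //; apply: big1 => u uv; apply/eqP.
  apply: contraT => /v_min; rewrite leqNgt => /negP[]; exact: rank_lt.
have [m mP] := choice min_support.
exists [tuple m j | j < n]; rewrite coupling_neq0; apply/forallP => p.
rewrite !tnth_mktuple; have [m1 l1] := mP p.1; have [_ ->] := mP p.2.
by rewrite cdf_lcdf l1 add0r lt_neqAle eq_sym m1 y_ge0.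
Qed.

Lemma coupling_geom :
  @geom R d (order_complex (ppow n P)) (normalize (coupling y)).
Proof.
apply: normalize_geom; [exact: coupling_ge0|exact: coupling_ex|].
apply: chains_neq0_support; [exact: coupling_ex|exact: coupling_chain].
Qed.

Lemma coupling_perm (g : 'S_n) v :
  coupling (fun j => y (g j)) (pperm g v) = coupling y v.
Proof.
rewrite /coupling (reindex (fun p => ((g^-1)%g p.1, (g^-1)%g p.2))) /=;
  last first.
  exists (fun p => (g p.1, g p.2)) => -[i j] _ /=; by rewrite ?permK ?permKV.
by apply: eq_bigr => p _; rewrite !tnth_pperm !permKV.
Qed.
End Coupling.

(* In barycentric coordinates on [|K(S)|], a face gets a positive weight exactly
   when it is a superlevel set; the superlevel sets of a point form a chain. *)
Section Superlevel.
Context (R : realType) (d : Order.disp_t) (S : finPOrderType d).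
Local Notation K := (order_complex S).

Definition superlevel (x : S -> R) (s : face K) : R :=
  \prod_(u in val s) x u *
  \prod_(p : S * S | (p.1 \in val s) && (p.2 \notin val s)) pos (x p.1 - x p.2).

Variable x : S -> R.
Hypothesis x_geom : @geom R d K x.

Let x_ge0 v : 0 <= x v. Proof. by have [] := x_geom. Qed.

Lemma superlevel_ge0 (s : face K) : 0 <= superlevel x s.
Proof. by apply: mulr_ge0; apply: prodr_ge0 => // p _; exact: pos_ge0. Qed.

Lemma superlevelP (s : face K) : reflect
  ((forall u, u \in val s -> x u != 0) /\
   forall u v, u \in val s -> v \notin val s -> x v < x u)
  (superlevel x s != 0).
Proof.
rewrite mulf_eq0 negb_or; apply: (iffP andP) => -[].
  move=> /prodf_neq0 xs /prodf_neq0 xlt; split=> // u v us vs.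
  by have := xlt (u, v); rewrite /= us vs pos_neq0 subr_gt0; apply.
move=> xs xlt; split; first exact/prodf_neq0.
apply/prodf_neq0 => -[u v] /andP[us vs].
by rewrite /= pos_neq0 subr_gt0; exact: xlt.
Qed.

Lemma superlevel_ex : exists s : face K, superlevel x s != 0.
Proof.
have [v0 v0P] := geom_neq0 x_geom.
have v0T : xpredT v0 by [].
case: (@Order.TotalTheory.arg_maxP _ _ _ v0 xpredT x v0T) => m _ m_max.
have xm : 0 < x m.
  by apply: lt_le_trans (m_max v0 isT); rewrite lt_neqAle eq_sym v0P x_ge0.
pose t := [set v | x v == x m]%SET.
have tK : t \in simp K.
  have [_ _ [s sK xs]] := x_geom; apply: (@simp_subset _ K s t m sK).
    by rewrite inE.
  apply/fintype.subsetP => v; rewrite inE => /eqP xv; apply: xs.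
  by rewrite xv gt_eqF.
exists (exist _ t tK); apply/superlevelP; split=> [u|u v] /=; rewrite !inE.
  by move=> /eqP->; rewrite gt_eqF.
by move=> /eqP-> vm; rewrite lt_neqAle vm; exact: m_max.
Qed.

Lemma superlevel_chain (s t : face K) :
  superlevel x s != 0 -> superlevel x t != 0 -> (s >=< t)%O.
Proof.
move=> /superlevelP[_ xs] /superlevelP[_ xt]; apply: contrapT => /negP.
rewrite negb_or => /andP[/subsetPn[u us ut] /subsetPn[v vt vs]].
by have := lt_trans (xs _ _ us vs) (xt _ _ vt ut); rewrite ltxx.
Qed.

Lemma superlevel_geom :
  @geom R d (order_complex (face K)) (normalize (superlevel x)).
Proof.
apply: normalize_geom; [exact: superlevel_ge0|exact: superlevel_ex|].
apply: chains_neq0_support; [exact: superlevel_ex|exact: superlevel_chain].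
Qed.

Lemma superlevel_bij (h : {omorphism S -> S}) (x' : S ->
  R) (s : face K) : bijective h ->
  (forall v, x' (h v) = x v) ->
  superlevel x' (face_map (order_complex_map h) s) = superlevel x s.
Proof.
move=> h_bij xx'; have h_inj := bij_inj h_bij; rewrite /superlevel;
  congr (_ * _).
  rewrite big_imset /=; first exact: eq_bigr.
  by move=> u v _ _; exact: h_inj.
have [h' hK h'K] := h_bij.
rewrite (reindex (fun p : S * S => (h p.1, h p.2))) /=; last first.
  by exists (fun p => (h' p.1, h' p.2)) => -[u v] _ /=; rewrite ?hK ?h'K.
apply: eq_big => [p|p _]; last by rewrite !xx'.
by rewrite /= !mem_imset.
Qed.
End Superlevel.

(** * The map from |K(P)|^n to the subdivisions of K(P^n) *)

Section Kappa.
Context (R : realType) (d : Order.disp_t) (n : nat) (P : finPOrderType d).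

Fixpoint kappa (r : nat) (y : 'I_n -> P -> R) : sdp r (ppow n P) -> R :=
  match r return sdp r (ppow n P) -> R with
  | 0 => normalize (coupling y)
  | r'.+1 => normalize (superlevel (@kappa r' y))
  end.

Arguments kappa : clear implicits.

Lemma kappa_geom r y : (forall j, @geom R d (order_complex P) (y j)) ->
  @geom R d (order_complex (sdp r (ppow n P))) (kappa r y).
Proof.
move=> y_geom; elim: r => [|r IH]; first exact: coupling_geom.
exact: superlevel_geom.
Qed.

(** A face of nonzero weight consists of vertices of nonzero weight at the previous level, its
    largest one included. This ties [tau_iter] to the supports of the given points. *)
Lemma kappa_support r y v j : (forall j, @geom R d (order_complex P) (y j)) ->
  kappa r y v != 0 -> y j (tnth (tau_iter v) j) != 0.
Proof.
move=> y_geom; elim: r v => [|r IH] v /= /normalize_neq0.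
  exact: coupling_support.
move=> /superlevelP[xs _]; apply: IH; apply: xs; exact: max_vertex_in.
Qed.

Lemma sdp_pperm_bij r (g : 'S_n) : bijective (sdp_map (@pperm d n P g) r).
Proof.
exists (sdp_map (@pperm d n P g^-1%g) r); first exact: sdp_ppermK.
by have := @sdp_ppermK d n P r g^-1%g; rewrite invgK.
Qed.

Lemma kappa_perm r y (g : 'S_n) v :
  kappa r (fun j => y (g j)) (sdp_map (@pperm d n P g) r v) = kappa r y v.
Proof.
elim: r v => [|r IH] v.
  apply: (@normalize_bij _ _ (@pperm d n P g));
    first exact: (sdp_pperm_bij 0 g).
  by move=> u; exact: coupling_perm.
apply: (@normalize_bij _ _ (sdp_map (@pperm d n P g) r.+1)).
  exact: (sdp_pperm_bij r.+1 g).
by move=> u; apply: superlevel_bij => //; exact: sdp_pperm_bij.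
Qed.

Lemma kappa_continuous r v :
  continuous (fun y : {ptws 'I_n -> realization R (order_complex P)} =>
    kappa r (fun j => bcoord (y j)) v).
Proof.
have y_geom (y : {ptws 'I_n -> realization R (order_complex P)}) j :
  @geom R d (order_complex P) (bcoord (y j)) by exact: bcoord_geom.
have coord_cont j u :
    continuous (fun y : {ptws 'I_n -> realization R (order_complex P)} =>
      bcoord (y j) u).
  move=> y; apply: (@continuous_comp _ _ _
    (fun y : {ptws 'I_n -> realization R (order_complex P)} => y j)
    (fun x => bcoord x u)).
    exact: ptws_proj_continuous.
  exact: bcoord_continuous.
elim: r v => [|r IH] v y /=.
  apply: normalize_continuous => [u|]; last first.
    rewrite gt_eqF//; apply: sumr_gt0_neq0; last exact: coupling_ex.
    exact: coupling_ge0.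
  apply: continuous_prod => p _; apply: pos_continuous; apply: continuousB;
    by apply: continuous_sum => w _; exact: coord_cont.
apply: normalize_continuous => [u|]; last first.
  rewrite gt_eqF//; apply: sumr_gt0_neq0.
    by move=> u; apply: superlevel_ge0; exact: kappa_geom.
  by apply: superlevel_ex; exact: kappa_geom.
apply: continuousM; first by apply: continuous_prod => w _; exact: IH.
by apply: continuous_prod => p _; apply: pos_continuous; apply: continuousB;
  exact: IH.
Qed.
End Kappa.

Arguments kappa {R d n P} r y v.

(** * Polygonal lines in a realization *)

Section Polyline.
Context (R : realType).

Definition ramp (r : R) : R := Num.min 1 (Num.max 0 r).

Lemma ramp_le0 r : r <= 0 -> ramp r = 0.
Proof. by move=> r0; rewrite /ramp (max_idPl r0) (min_idPr ler01). Qed.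

Lemma ramp_ge1 r : 1 <= r -> ramp r = 1.
Proof. by move=> r1; rewrite /ramp (max_idPr (le_trans ler01 r1)) (min_idPl
  r1). Qed.

Lemma ramp_ge0 r : 0 <= ramp r.
Proof. by rewrite le_min ler01 le_max lexx. Qed.

Lemma ramp_le1 r : ramp r <= 1.
Proof. by rewrite ge_min lexx. Qed.

Lemma ramp_continuous (T : topologicalType) (f : T -> R) x :
  {for x, continuous f} -> {for x, continuous (fun y => ramp (f y))}.
Proof.
move=> fx; rewrite (_ : (fun _ => _) = (fun=> 1) \min ((fun=> 0) \max f))//.
apply: continuous_min; first exact: cvg_cst.
by apply: continuous_max => //; exact: cvg_cst.
Qed.

(* The point [Psi l] is reached at time [l]. *)
Fixpoint polyline (V : Type) (Psi : nat -> V -> R) (m : nat) (t : R) : V -> R :=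
  if m is m'.+1 then fun v =>
    (1 - ramp (t - m'%:R)) * polyline Psi m' t v + ramp (t - m'%:R) * Psi m'.+1
      v
  else Psi 0%N.

Lemma polyline_start (V : Type) (Psi : nat -> V -> R) m t : t <= 0 ->
  polyline Psi m t = Psi 0%N.
Proof.
move=> t0; elim: m => //= m ->; apply/funext => v.
by rewrite ramp_le0 ?subr0 ?mul1r ?mul0r ?addr0// subr_le0 (le_trans t0).
Qed.

Lemma polyline_at (V : Type) (Psi : nat -> V -> R) m t : m%:R <= t ->
  polyline Psi m t = Psi m.
Proof.
case: m => [//|m] mt; apply/funext => v /=.
by rewrite ramp_ge1 ?subrr ?mul0r ?add0r ?mul1r// lerBrDr nat1r.
Qed.

Lemma eq_polyline (V : Type) (Psi Psi' : nat -> V -> R) m t :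
  (forall l, (l <= m)%N -> Psi l = Psi' l) ->
    polyline Psi m t = polyline Psi' m t.
Proof.
elim: m => [|m IH] eqPsi /=; first exact: eqPsi.
by rewrite IH ?eqPsi// => l lm; exact/eqPsi/leqW.
Qed.

Lemma geom_convex (d : Order.disp_t) (M : ocomplex d) (x y : M -> R) (a : R) s :
  0 <= a <= 1 -> geom x -> geom y -> s \in simp M -> support_in s x ->
  support_in s y -> geom (fun v => (1 - a) * x v + a * y v).
Proof.
move=> /andP[a0 a1] [x_ge0 x_sum _] [y_ge0 y_sum _] sM xs ys; split=> [v||].
- by rewrite addr_ge0 ?mulr_ge0// subr_ge0.
- by rewrite big_split/= -!mulr_sumr x_sum y_sum !mulr1 subrK.
exists s => // v; have [xv|/xs//] := eqVneq (x v) 0.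
by have [yv|/ys//] := eqVneq (y v) 0; rewrite xv yv !mulr0 addr0 eqxx.
Qed.

(** Up to time [m] the new term has weight 0, and after it the earlier line rests at [Psi m]; only
    two consecutive points are ever mixed, inside a common simplex. *)
Lemma polyline_geom (d : Order.disp_t) (M : ocomplex d) (Psi : nat -> M ->
  R) m t :
  (forall l, (l <= m)%N -> geom (Psi l)) ->
  (forall l, (l < m)%N -> exists2 s, s \in simp M &
     support_in s (Psi l) /\ support_in s (Psi l.+1)) ->
  geom (polyline Psi m t).
Proof.
elim: m => [|m IH] Psi_geom Psi_simp /=; first exact: Psi_geom.
have gm : geom (polyline Psi m t).
  by apply: IH => l lm; [exact/Psi_geom/leqW|exact/Psi_simp/leqW].
have [tm|mt] := leP (t - m%:R) 0.
  rewrite (_ : (fun v => _) = polyline Psi m t)//; apply/funext => v.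
  by rewrite ramp_le0// subr0 mul1r mul0r addr0.
move: gm; rewrite polyline_at; last by rewrite -subr_ge0 ltW.
move=> gm; have [s sM [sm sm1]] := Psi_simp m (ltnSn m).
apply: (geom_convex _ gm (Psi_geom _ _) sM) => //.
by rewrite ramp_ge0 ramp_le1.
Qed.

Lemma polyline_continuous (T : topologicalType) (V : Type)
    (Psi : T -> nat -> V -> R) (f : T -> R) m x v :
  (forall l u, (l <= m)%N -> {for x, continuous (fun y => Psi y l u)}) ->
  {for x, continuous f} ->
    {for x, continuous (fun y => polyline (Psi y) m (f y) v)}.
Proof.
move=> Psi_cont f_cont; elim: m Psi_cont => [|m IH] Psi_cont /=.
  exact: Psi_cont.
have r_cont : {for x, continuous (fun y => ramp (f y - m%:R))}.
  by apply: ramp_continuous; apply: continuousB => //; exact: cvg_cst.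
apply: continuousD; apply: continuousM => //.
- by apply: continuousB => //; exact: cvg_cst.
- by apply: IH => l u lm; exact/Psi_cont/leqW.
- exact: Psi_cont.
Qed.

Lemma affine_ext_support (V W : finType) (f : V -> W) (x : V ->
  R) (s : {set V}) :
  support_in s x -> support_in (f @: s)%SET (affine_ext f x).
Proof.
move=> xs w; apply: contraR => ws; apply/eqP/big1 => v /eqP fv.
apply/eqP; apply: contraNT ws => /xs vs; rewrite -fv; exact: imset_f.
Qed.

Lemma affine_ext_geom (d d' : Order.disp_t) (M : ocomplex d) (N : ocomplex d')
    (f : M -> N) (x : M -> R) s :
  geom x -> support_in s x -> (f @: s)%SET \in simp N -> geom (affine_ext f x).
Proof.
move=> [x_ge0 x_sum _] xs fsN; split=> [w||]; first by apply: sumr_ge0.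
  by rewrite -x_sum [RHS](partition_big f xpredT).
by exists (f @: s)%SET => //; exact: affine_ext_support.
Qed.

Lemma affine_ext_bij (V W : finType) (h : V -> V) (f f' : V ->
  W) (x x' : V -> R) :
  bijective h -> (forall v, x' (h v) = x v) ->
  (forall v, x v != 0 -> f' (h v) = f v) -> affine_ext f' x' = affine_ext f x.
Proof.
move=> h_bij xx' ff'; apply/funext => w; rewrite /affine_ext.
rewrite big_mkcond [RHS]big_mkcond (reindex h) /=; last exact: onW_bij.
apply: eq_bigr => v _; rewrite xx'.
have [->|/ff'->//] := eqVneq (x v) 0; by rewrite !if_same.
Qed.
End Polyline.

(** * Equivariant sections from symmetric contiguities *)

Section CCtoTC.
Context (R : realType) (d : Order.disp_t) (n : nat) (P : finPOrderType d).
Hypothesis n_gt0 : (0 < n)%N.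
Variable r : nat.

Local Notation X := (realization R (order_complex P)).
Local Notation S := (sdp r (ppow n P)).
Local Notation act := (fun g : 'S_n => sdp_map (@pperm d n P g) r).

Section OneSet.
Variable Q : {set S}.
Hypothesis Q_act : forall (g : 'S_n) x, x \in Q -> act g x \in Q.
Variables (c : nat) (phi0 : S -> P) (psi : nat -> 'I_n -> S -> P).
Hypothesis psi_simp :
  forall j l, (l <= c)%N -> simplicial (chains_in Q) (chains P) (psi l j).
Hypothesis psi_ends : forall j v, v \in Q ->
  psi 0 j v = phi0 v /\ psi c j v = tnth (tau_iter v) j.
Hypothesis psi_step : forall j l s, (1 <= l <= c)%N -> s \in chains_in Q ->
  (psi l.-1 j @: s :|: psi l j @: s)%SET \in chains P.
Hypothesis psi_act : forall (g : 'S_n) j l v, (l <= c)%N -> v \in Q ->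
  psi l j (act g v) = psi l (g j) v.

Definition weight (y : {ptws 'I_n -> X}) (v : S) : R :=
  if v \in Q then kappa r (fun j => bcoord (y j)) v else 0.

(* An open neighbourhood of [|K(Q)|], which [retract] moves into [|K(Q)|] inside
   each simplex. *)
Definition domain : set {ptws 'I_n -> X} := [set y | 0 < \sum_v weight y v].

Definition retract (y : {ptws 'I_n -> X}) : S -> R := normalize (weight y).

(** The waypoint [c + 1] is the given point itself; the affine image under [psi c] need not equal
    it, and merely shares a simplex with it. *)
Definition waypoint (y : {ptws 'I_n -> X}) (j : 'I_n) (l : nat) : P -> R :=
  if (l <= c)%N then affine_ext (psi l j) (retract y) else bcoord (y j).

Definition leg (y : {ptws 'I_n -> X}) (j : 'I_n) (t : R) : P -> R :=
  polyline (waypoint y j) c.+1 (c.+1%:R * t).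

Let y_geom (y : {ptws 'I_n ->
  X}) j : @geom R d (order_complex P) (bcoord (y j)).
Proof. exact: bcoord_geom. Qed.

Let kappaP (y : {ptws 'I_n -> X}) : @geom R d (order_complex S)
  (kappa r (fun j => bcoord (y j))).
Proof. by apply: kappa_geom => j; exact: y_geom. Qed.

Lemma weight_ge0 y v : 0 <= weight y v.
Proof. by rewrite /weight; case: ifP => // _; have [] := kappaP y. Qed.

Lemma weight_perm (g : 'S_n) y v : weight (xperm g y) (act g v) = weight y v.
Proof.
rewrite /weight; have -> : (act g v \in Q) = (v \in Q).
  apply/idP/idP => [|/Q_act//] gvQ.
  have gK := @sdp_ppermK d n P r g.
  by rewrite -(gK v); exact: Q_act.
by case: ifP => // _; exact: (kappa_perm (fun j => bcoord (y j)) g v).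
Qed.

Lemma weight_continuous v : continuous (fun y => weight y v).
Proof.
move=> y; have [vQ|vQ] := boolP (v \in Q).
  rewrite (_ : (fun y => weight y v) =
    fun y : {ptws 'I_n -> X} => kappa r (fun j => bcoord (y j)) v).
    exact: kappa_continuous.
  by apply/funext => x; rewrite /weight vQ.
rewrite (_ : (fun y => weight y v) = fun=> 0).
  exact: cst_continuous.
by apply/funext => x; rewrite /weight (negPf vQ).
Qed.

Lemma domain_open : open domain.
Proof.
rewrite openE => y y0; rewrite /interior.
have sum_cont : (fun y => \sum_v weight y v) @ y --> \sum_v weight y v.
  by apply: continuous_sum => v _; exact: weight_continuous.
exact: (cvgr_gt _ sum_cont _ y0).
Qed.

Lemma domain_perm (g : 'S_n) y : domain y -> domain (xperm g y).
Proof.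
move=> y_dom; rewrite /domain /= (reindex (act g)) /=; last first.
  exact/onW_bij/sdp_pperm_bij.
by rewrite (eq_bigr (weight y)) // => v _; exact: weight_perm.
Qed.

(** The last clause prepares the final segment of [leg]: [psi c j] sends the support of the
    retracted point into the support of [y j]. *)
Lemma retract_support y : domain y ->
  exists s : {set S}, [/\ s \in chains_in Q, support_in s (retract y) &
    forall v, v \in s -> forall j, bcoord (y j) (tnth (tau_iter v) j) != 0].
Proof.
move=> y_dom; have w_ex : exists v, weight y v != 0.
  apply: contrapT => w0; move: y_dom; rewrite /domain /= big1 ?ltxx// => v _.
  by apply/eqP; apply: contrapT => wv; apply: w0; exists v; exact/negP.
have w_kappa v : weight y v != 0 ->
    v \in Q /\ kappa r (fun j => bcoord (y j)) v != 0.
  by rewrite /weight; case: ifP => // _; rewrite eqxx.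
exists [set v | weight y v != 0]%SET; split.
- apply/chains_inP; split; last by move=> v; rewrite inE => /w_kappa[].
  apply/chainsP; split.
    by have [v wv] := w_ex; apply/set0Pn; exists v; rewrite inE.
  move=> u v; rewrite !inE => /w_kappa[_ ku] /w_kappa[_ kv].
  exact: geom_comparable (kappaP y) ku kv.
- by move=> v; rewrite inE; exact: normalize_neq0.
- move=> v; rewrite inE => /w_kappa[_ kv] j.
  by apply: kappa_support kv => i; exact: y_geom.
Qed.

Lemma retract_geom y : domain y -> @geom R d (order_complex S) (retract y).
Proof.
move=> y_dom; have [s [/chains_inP[sc _] _ _]] := retract_support y_dom.
apply: normalize_geom; first exact: weight_ge0.
  apply: contrapT => w0; move: y_dom; rewrite /domain /= big1 ?ltxx// => v _.
  by apply/eqP; apply: contrapT => wv; apply: w0; exists v; exact/negP.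
have [_ _ [t tS ty]] := kappaP y; exists t => // v.
by rewrite /weight; case: ifP => [_ /ty//|]; rewrite eqxx.
Qed.

Lemma leg_geom y j t : domain y -> @geom R d (order_complex P) (leg y j t).
Proof.
move=> y_dom; have [s [sQ ys y_tau]] := retract_support y_dom.
have z_geom := retract_geom y_dom.
apply: (@polyline_geom R d (order_complex P)) => l lc; rewrite /waypoint.
  case: leqP => lc'; last exact: y_geom.
  by apply: affine_ext_geom z_geom ys _; exact: psi_simp.
rewrite -ltnS lc; case: leqP => [cl|lc']; last first.
  exists (psi l j @: s :|: psi l.+1 j @: s)%SET;
    first exact: (psi_step j (l := l.+1)).
  split=> w /affine_ext_support => /(_ _ ys) ws; rewrite inE ws ?orbT//.
have -> : l = c by apply/eqP; rewrite eqn_leq -ltnS lc cl.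
have [_ _ [t' t'P yt']] := y_geom y j; exists t' => //; split=> // w.
move=> /(affine_ext_support ys)/imsetP[v vs ->].
have vQ : v \in Q by move: sQ => /chains_inP[_ /(_ _ vs)].
by have [_ ->] := psi_ends j vQ; exact/yt'/y_tau.
Qed.

Lemma leg0 y i j : domain y -> leg y i 0 = leg y j 0.
Proof.
move=> y_dom; have [s [/chains_inP[_ sQ] ys _]] := retract_support y_dom.
rewrite /leg mulr0 !polyline_start// /waypoint /=.
apply: (@affine_ext_bij _ _ _ id) => //; first by exists id.
by move=> v /ys/sQ vQ; have [-> _] := psi_ends i vQ;
  have [-> _] := psi_ends j vQ.
Qed.

Lemma leg1 y j : leg y j 1 = bcoord (y j).
Proof. by rewrite /leg mulr1 polyline_at// /waypoint ltnn. Qed.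

Lemma leg_perm (g : 'S_n) y j t : domain y ->
  leg (xperm g y) j t = leg y (g j) t.
Proof.
move=> y_dom; have [s [/chains_inP[_ sQ] ys _]] := retract_support y_dom.
apply: eq_polyline => l _; rewrite /waypoint; case: leqP => // lc.
apply: (@affine_ext_bij _ _ _ (act g)); first exact: sdp_pperm_bij.
  move=> v; apply: (@normalize_bij _ _ (act g)); first exact: sdp_pperm_bij.
  exact: weight_perm.
by move=> v /ys/sQ; exact: psi_act.
Qed.

Lemma leg_continuous y j t v : domain y ->
  {for (y, t), continuous (fun p : {ptws 'I_n -> X} * R => leg p.1 j p.2 v)}.
Proof.
move=> y_dom; apply: polyline_continuous; last first.
  by apply: continuousM; [exact: cvg_cst|exact: cvg_snd].
move=> l w _; apply: (@continuous_comp _ _ _ fst (fun y => waypoint y j l w)).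
  exact: cvg_fst.
rewrite /waypoint /=; case: leqP => lc.
  apply: continuous_sum => u _; apply: normalize_continuous.
    by move=> u'; exact: weight_continuous.
  by rewrite gt_eqF.
apply: (@continuous_comp _ _ _ (fun y : {ptws 'I_n -> X} => y j)
    (fun x => bcoord x w)).
  exact: ptws_proj_continuous.
exact: bcoord_continuous.
Qed.

Lemma domain_section : exists s : {ptws 'I_n -> X} -> star_maps R n X,
  [/\ {within domain, continuous s},
      forall (g : 'S_n) y, domain y -> forall t j,
        set_val (s (xperm g y)) (spt t j) = set_val (s y) (spt t (g j)) &
      forall y, domain y -> forall j, set_val (s y) (spt (ui1 R) j) = y j].
Proof.
have star_leg y : exists f : star_maps R n X, domain y -> forall t j,
    bcoord (set_val f (spt t j)) = leg y j (set_val t).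
  have [y_dom|y_ndom] := pselect (domain y); last first.
    (* Outside [domain] a constant map serves as junk value. *)
    have cst_cont : continuous ((fun=> y (Ordinal n_gt0)) : star R n -> X).
      exact: cst_continuous.
    by exists (SigSub (mem_set cst_cont)).
  pose pt j (t : unit_interval R) : X :=
    SigSub (mem_set (leg_geom j (set_val t) y_dom)).
  have bcoord_pt j t : bcoord (pt j t) = leg y j (set_val t) by [].
  have pt0 i j : pt i (ui0 R) = pt j (ui0 R).
    by apply: val_inj => /=; exact: leg0.
  have pt_cont j : continuous (pt j).
    move=> t; apply: (@realization_cvg _ _ _ _ (nbhs t) (pt j) (pt j t)
      (nbhs_filter t)) => v.
    apply: (@continuous_comp _ _ _ (fun u : unit_interval R => (y, set_val u))
      (fun p : {ptws 'I_n -> X} * R => leg p.1 j p.2 v)).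
      apply: continuous_pair; first exact: cst_continuous.
      exact: set_val_continuous.
    exact: (@leg_continuous y j (set_val t) v y_dom).
  have f_cont := wedge_fun_continuous pt_cont pt0.
  exists (SigSub (mem_set f_cont)) => _ t j.
  by rewrite -bcoord_pt; congr bcoord; exact: wedge_lift_funE.
have [s sP] := choice star_leg; exists s; split.
- rewrite continuous_open_subspace; last exact: domain_open.
  move=> y; rewrite inE => y_dom; apply: star_maps_cvg => j t.
  apply: realization_cvg => v; rewrite sP//.
  have leg_cont : leg z.1 j (set_val z.2) v @[z --> (y,
    t)] --> leg y j (set_val t) v.
    apply: (@continuous_comp _ _ _
      (fun z : {ptws 'I_n -> X} * unit_interval R => (z.1, set_val z.2))
      (fun p : {ptws 'I_n -> X} * R => leg p.1 j p.2 v) (y, t)).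
      apply: continuous_pair; first exact: cvg_fst.
      apply: (@continuous_comp _ _ _ snd set_val (y, t)); first exact: cvg_snd.
      exact: set_val_continuous.
    exact: (@leg_continuous y j (set_val t) v y_dom).
  apply: cvg_trans leg_cont; apply: near_eq_cvg.
  exists (domain, setT).
    by split; [apply: open_nbhs_nbhs; split => //;
      exact: domain_open|exact: filterT].
  by move=> z [/= z_dom _]; rewrite sP.
- move=> g y y_dom t j; apply: val_inj.
  have := sP _ (domain_perm g y_dom) t j; rewrite leg_perm// -sP//.
- move=> y y_dom j; apply: val_inj; have := sP _ y_dom (ui1 R) j.
  by rewrite leg1.
Qed.
End OneSet.

Lemma CC_cover_TC_cover m k : CC_cover n P r m k ->
  TC_cover R n (realization R (order_complex P)) k.
Proof.
move=> cc; have [Q [Q_cover QP]] :=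
  @CC_poset_contiguous d n P S act (@tau_iter _ _ r) (@sdp_ppermK d n P r)
    n_gt0 m k cc.
exists (fun i => domain (Q i)).
have sections i : exists s : {ptws 'I_n -> X} -> star_maps R n X,
  [/\ {within domain (Q i), continuous s},
      forall (g : 'S_n) y, domain (Q i) y -> forall t j,
        set_val (s (xperm g y)) (spt t j) = set_val (s y) (spt t (g j)) &
      forall y, domain (Q i) y ->
        forall j, set_val (s y) (spt (ui1 R) j) = y j].
  have [_ Q_act [phi0 [c [psi [[_ _] _ spsi epsi [cpsi ipsi]]]]]] := QP i.
  apply: (@domain_section (Q i) Q_act c phi0 psi) => //.
  - by move=> j v vQ; apply: epsi; rewrite chains_in1.
  - by move=> g j l v lc vQ; apply: ipsi; rewrite ?chains_in1.
have [s sP] := choice sections; exists s; split.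
  apply/seteqP; split=> // y _.
  have y_geom j : @geom R d (order_complex P) (bcoord (y j)) by exact:
    bcoord_geom.
  (* Some vertex has nonzero weight under [kappa], and a set [Q i] containing it gives [y] a
     positive total weight. *)
  have [v kv] := geom_neq0 (kappa_geom r y_geom).
  have [i vQi] := Q_cover v; exists i => //; apply: sumr_gt0_neq0.
    exact: weight_ge0.
  by exists v; rewrite /weight vQi.
move=> i; have [s_cont s_equiv s_end] := sP i; have [_ Q_act _] := QP i;
  split=> //.
  exact: domain_open.
move=> g; apply/seteqP; split=> [_ [y y_dom <-]|y y_dom];
  first exact: domain_perm.
exists (xperm g^-1%g y); first exact: domain_perm.
by apply/funext => j; rewrite /xperm permK.
Qed.
End CCtoTC.

(** * From topological to simplicial complexity *)

Section VertexPositions.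
Context (R : realType) (d : Order.disp_t) (M : ocomplex d).

(* The image in [|M|] of a vertex of [sd^r M] under the homeomorphism
   [|sd^r M| -> |M|], in barycentric coordinates. *)
Fixpoint vpos (r : nat) : sdc r M -> M -> R :=
  match r return sdc r M -> M -> R with
  | 0 => @unit_mass R M
  | r'.+1 => fun (s : face (sdc r' M)) w =>
      (\sum_(u in val s) @vpos r' u w) / #|val s|%:R
  end.

Definition place (r : nat) (x : sdc r M -> R) (w : M) : R :=
  \sum_u x u * vpos u w.

Lemma card_simp_gt0 (N : ocomplex d) (s : {set N}) :
  s \in simp N -> 0 < #|s|%:R :> R.
Proof. by move=> /simp_neq0 s0; rewrite ltr0n card_gt0. Qed.

Lemma vpos_ge0 r (v : sdc r M) w : 0 <= vpos v w.
Proof.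
elim: r v => [|r IH] v /=; first exact: ler0n.
by rewrite divr_ge0// sumr_ge0.
Qed.

Lemma sum_vpos r (v : sdc r M) : \sum_w vpos v w = 1.
Proof.
elim: r v => [|r IH] v /=.
  rewrite (bigD1 (v : M))//= big1 ?addr0 /unit_mass ?eqxx// => u /negPf.
  by move=> ->.
rewrite -mulr_suml exchange_big /= (eq_bigr _ (fun u _ => IH u)).
by rewrite sumr_const divff// gt_eqF// (card_simp_gt0 (valP v)).
Qed.

Lemma vpos_carrier r (v : sdc r M) w : vpos v w != 0 -> w \in carrier v.
Proof.
elim: r v => [|r IH] v /=.
  by rewrite /unit_mass inE pnatr_eq0 eqb0 negbK.
apply: contraR => wv; apply/eqP; rewrite big1 ?mul0r// => u uv.
apply/eqP; apply: contraNT wv => /IH wu; by apply/bigcupP; exists u.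
Qed.

Lemma place_geom r (x : sdc r M -> R) : geom x -> geom (place x).
Proof.
move=> [x_ge0 x_sum [s sM xs]]; split=> [w||].
- by apply: sumr_ge0 => u _; rewrite mulr_ge0// vpos_ge0.
- rewrite exchange_big /= -x_sum; apply: eq_bigr => u _.
  by rewrite -mulr_sumr sum_vpos mulr1.
exists (\bigcup_(v in s) carrier v)%SET; first exact: carrier_simp.
move=> w; apply: contraR => ws; apply/eqP/big1 => u _.
have [->|/xs us] := eqVneq (x u) 0; first by rewrite mul0r.
have [->|/vpos_carrier wu] := eqVneq (vpos u w) 0; first by rewrite mulr0.
by case/negP: ws; apply/bigcupP; exists u.
Qed.

Lemma vpos_comp (a : forall i, smap (sdc i.+1 M) (sdc i M)) r (v : sdc r M) :
  (forall i (u : face (sdc i M)), a i u \in val u) -> 0 < vpos v (sdc_comp a v).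
Proof.
move=> av; elim: r v => [|r IH] v /=; first by rewrite /unit_mass eqxx ltr01.
rewrite divr_gt0 ?(card_simp_gt0 (valP v))// (bigD1 (a r v)) ?av//=.
by rewrite ltr_wpDr ?IH// sumr_ge0// => u _; exact: vpos_ge0.
Qed.

(** The faces in a chain have distinct cardinalities between 1 and [#|M|]. The bound does not depend
    on [r], so one contraction factor serves all subdivisions. *)
Lemma card_simp_le r (s : {set sdc r M}) : s \in simp (sdc r M) ->
  (#|s| <= #|M|)%N.
Proof.
elim: r s => [|r IH] s sM; first exact: max_card.
have card_lt (v : face (sdc r M)) : (#|val v|.-1 < #|M|)%N.
  have v_le := IH _ (valP v); rewrite prednK// card_gt0.
  exact: simp_neq0 (valP v).
pose f (v : face (sdc r M)) := Ordinal (card_lt v).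
rewrite -(card_ord #|M|); apply: leq_trans (max_card (mem (f @: s))).
rewrite card_in_imset// => u v us vs /(congr1 val) /= uv.
have card_eq : #|val u| = #|val v|.
  have u0 : (0 < #|val u|)%N by rewrite card_gt0; exact: simp_neq0 (valP u).
  have v0 : (0 < #|val v|)%N by rewrite card_gt0; exact: simp_neq0 (valP v).
  by rewrite -(prednK u0) -(prednK v0) uv.
have /chainsP[_ /(_ _ _ us vs)/orP[sub|sub]] := sM.
  apply: (@val_inj _ _ (face (sdc r M))); apply/eqP.
  by rewrite eqEcard card_eq leqnn andbT; exact: sub.
apply/esym/(@val_inj _ _ (face (sdc r M)))/eqP.
by rewrite eqEcard card_eq leqnn andbT; exact: sub.
Qed.

(** The factor [N / (N + 1)] with [N = #|M|], slightly cruder than the usual [1 - 1 / N]; its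
    denominator is positive for every [M]. *)
Definition shrink : R := 1 - #|M|.+1%:R^-1.

Lemma shrink_ge0 : 0 <= shrink.
Proof. by rewrite subr_ge0 invf_le1 ?ltr0n// ler1n. Qed.

(** The difference of the averages is the average of [f u - f v] over [s] times [t]. As [s] is
    inside [t], each [u] has a vanishing diagonal term, which leaves a proportion [1 - 1 / #|t|] of
    the terms. *)
Lemma average_sub (V : finType) (s t : {set V}) (f : V -> R) (e : R) :
  s != finset.set0 -> s \subset t -> (#|t| <= #|M|)%N ->
  {in t &, forall u v, `|f u - f v| <= e} -> 0 <= e ->
  `|(\sum_(u in s) f u) / #|s|%:R - (\sum_(v in t) f v) / #|t|%:R| <= shrink *
    e.
Proof.
move=> s0 /[dup] st /fintype.subsetP sub tM fe e0.
have s_gt0 : 0 < #|s|%:R :> R by rewrite ltr0n card_gt0.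
have t_gt0 : 0 < #|t|%:R :> R.
  by rewrite ltr0n; apply: leq_trans (subset_leq_card st); rewrite card_gt0.
have -> : (\sum_(u in s) f u) / #|s|%:R - (\sum_(v in t) f v) / #|t|%:R =
    (\sum_(u in s) \sum_(v in t) (f u - f v)) / (#|s|%:R * #|t|%:R).
  rewrite [X in _ = X / _](eq_bigr (fun u => f u *+ #|t| - \sum_(v in t) f v)).
    rewrite sumrB sumr_const sumrMnl.
    rewrite -[X in _ = (X - _) / _]mulr_natr -[X in _ = (_ - X) / _]mulr_natr.
    by field; rewrite !gt_eqF.
  by move=> u _; rewrite sumrB sumr_const.
rewrite normrM normfV (gtr0_norm (mulr_gt0 s_gt0 t_gt0)) ler_pdivrMr
  ?mulr_gt0//.
apply: le_trans (ler_norm_sum _ _ _) _.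
apply: (@le_trans _ _ (\sum_(u in s) (#|t|%:R - 1) * e)).
  apply: ler_sum => u us; apply: le_trans (ler_norm_sum _ _ _) _.
  rewrite (bigD1 u) ?sub//= subrr normr0 add0r.
  apply: (@le_trans _ _ (\sum_(v in t | v != u) e)).
    by apply: ler_sum => v /andP[vt _]; apply: fe => //; exact: sub.
  rewrite sumr_const -[leLHS]mulr_natl; apply: (ler_wpM2r e0).
  rewrite -(natrB _ (_ : 0 < #|t|)%N); last by rewrite -(ltr0n R).
  rewrite ler_nat leq_subRL; last by rewrite -(ltr0n R).
  by rewrite [leqRHS](cardD1 u) sub// leq_add2l; apply: eq_leq;
    apply: eq_card => v;
    rewrite !inE andbC.
rewrite sumr_const -[leLHS]mulr_natl.
rewrite [leRHS](_ : _ = #|s|%:R * ((#|t|%:R - #|t|%:R / #|M|.+1%:R) * e)).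
  rewrite ler_pM2l//; apply: (ler_wpM2r e0).
  rewrite lerD2l lerN2 ler_pdivrMr ?ltr0n// mul1r.
  by rewrite ler_nat leqW.
by rewrite /shrink; ring.
Qed.


(** Two vertices of a simplex of a subdivision are nested faces, placed at averages over a set and a
    superset, so each subdivision gains one factor [shrink]. *)
Lemma vpos_mesh r (s : {set sdc r M}) u v w : s \in simp (sdc r M) ->
  u \in s -> v \in s -> `|vpos u w - vpos v w| <= shrink ^+ r.
Proof.
elim: r s u v => [|r IH] s u v sM us vs.
  rewrite expr0 /= /unit_mass; case: (w == u); case: (w == v);
    by rewrite ?subrr ?subr0 ?sub0r ?normrN ?normr0 ?normr1 ?ler01.
rewrite exprS.
wlog uv : u v us vs / (u <= v)%O.
  move=> vpos_le; have /chainsP[_ /(_ _ _ us vs)/orP[uv|vu]] := sM.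
    exact: vpos_le.
  by rewrite distrC; exact: vpos_le.
apply: average_sub => [||||].
- exact: simp_neq0 (valP u).
- exact: uv.
- exact: card_simp_le (valP v).
- by move=> x y xv yv; exact: IH (valP v) xv yv.
- exact/exprn_ge0/shrink_ge0.
Qed.

Lemma place_close r (s : {set sdc r M}) x y e : geom x -> geom y ->
  s \in simp (sdc r M) -> support_in s x -> support_in s y ->
  shrink ^+ r < e -> sup_close e (place x) (place y).
Proof.
move=> [x_ge0 x1 _] [y_ge0 y1 _] sM xs ys re w; apply: le_lt_trans re.
(* A difference of two convex combinations is a convex combination of the differences of vertex
   positions. *)
have -> : place x w - place y w =
    \sum_u \sum_v x u * y v * (vpos u w - vpos v w).
  transitivity (\sum_u (x u * vpos u w - x u * place y w)).
    by rewrite sumrB -mulr_suml x1 mul1r.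
  apply: eq_bigr => u _; rewrite -mulrBr /place -[vpos u w]mul1r -{1}y1.
  rewrite mulr_suml -sumrB mulr_sumr; apply: eq_bigr => v _; ring.
have -> : shrink ^+ r = \sum_u \sum_v x u * y v * shrink ^+ r.
  rewrite -[LHS]mul1r -{1}x1 mulr_suml; apply: eq_bigr => u _.
  by rewrite -mulr_suml -mulr_sumr y1 mulr1.
apply: le_trans (ler_norm_sum _ _ _) _; apply: ler_sum => u _.
apply: le_trans (ler_norm_sum _ _ _) _; apply: ler_sum => v _.
rewrite normrM ger0_norm ?mulr_ge0//.
have [->|xu] := eqVneq (x u) 0; first by rewrite !mul0r.
have [->|yv] := eqVneq (y v) 0; first by rewrite mulr0 !mul0r.
apply: (ler_wpM2l (mulr_ge0 (x_ge0 u) (y_ge0 v))).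
exact: (vpos_mesh w sM (xs _ xu) (ys _ yv)).
Qed.

Lemma shrink_small e : 0 < e -> exists r, shrink ^+ r < e.
Proof.
move=> e0; have shrink1 : `|shrink| < 1.
  by rewrite ger0_norm ?shrink_ge0// /shrink ltrBlDr ltrDl invr_gt0 ltr0n.
have [r _ rP] := cvgr_lt _ (cvg_expr shrink1) _ e0.
by exists r; apply: (rP r) => /=.
Qed.

Lemma sdc_mapK (f f' : smap M M) r :
  cancel f f' -> cancel (sdc_map f r) (sdc_map f' r).
Proof.
move=> fK; elim: r => [//|r IH] s; apply: val_inj => /=.
rewrite -imset_comp (eq_imset _ (g := id)) ?imset_id// => x; exact: IH.
Qed.

Lemma vpos_bij (f f' : smap M M) r v w : cancel f f' ->
  vpos (sdc_map f r v) (f w) = vpos v w.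
Proof.
move=> fK; have f_inj := can_inj fK; elim: r v => [|r IH] v /=.
  by rewrite /unit_mass (inj_eq f_inj).
have inj_r := can_inj (sdc_mapK fK (r := r)).
rewrite big_imset /=; last by move=> x y _ _; exact: inj_r.
by rewrite (eq_bigr _ (fun u _ => IH u)) card_imset.
Qed.

Lemma place_bij (f f' : smap M M) r (x x' : sdc r M -> R) w :
  cancel f f' -> cancel f' f -> (forall v, x' (sdc_map f r v) = x v) ->
  place x' (f w) = place x w.
Proof.
move=> fK f'K xx'; rewrite /place (reindex (sdc_map f r)) /=; last first.
  by exists (sdc_map f' r) => v _; apply: sdc_mapK.
by apply: eq_bigr => v _; rewrite xx' (vpos_bij _ _ fK).
Qed.

Lemma geom_comp (N : ocomplex d) (f f' : smap N N) (x : N -> R) :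
  cancel f f' -> cancel f' f -> geom x -> geom (x \o f).
Proof.
move=> fK f'K [x_ge0 x1 [s sN xs]]; split=> [v||]; first exact: x_ge0.
  by rewrite -x1 [RHS](reindex f) //=; exists f' => v _.
exists (f' @: s)%SET; first exact: (sfunP f').
by move=> v /xs fvs; apply/imsetP; exists (f v).
Qed.
End VertexPositions.

(** * Lebesgue numbers on the product of a realization and the interval *)

Section LebesgueNumber.
Context (R : realType) (d : Order.disp_t) (M : ocomplex d).
Local Notation Y := (realization R M).
Local Notation I := (unit_interval R).

Lemma nbhs_sup_close (p : Y) e : 0 < e ->
  nbhs p [set q | sup_close e (bcoord p) (bcoord q)].
Proof.
move=> e0; apply: (filter_forall (nbhs_filter p)) => v.
by have /cvgrPdist_lt/(_ e e0) := @bcoord_continuous R d M v p.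
Qed.

(** Compactness in near-covering form, with the radius as a parameter tending to 0. Any property
    inherited by subsets is allowed for [good]: lying in one member of a cover, or admitting a
    uniform choice of vertices for all [i] and [j]. *)
Lemma lebesgue_number (good : set (Y * I) -> Prop) :
  (forall A B, A `<=` B -> good B -> good A) ->
  (forall z : Y * I, exists2 A : set (Y * I), nbhs z A & good A) ->
  exists2 e : R, 0 < e & forall (p : Y) (t : I), good [set z |
    sup_close e (bcoord p) (bcoord z.1) /\ `|set_val t - set_val z.2 : R| < e].
Proof.
move=> good_sub good_nbhs.
have YI_compact : compact [set: Y * I].
  rewrite -setXTT; apply: compact_setX; first exact: realization_compact.
  exact: unit_interval_compact.
move/compact_near_coveringP : YI_compact => /(_ R (0 : R)^'+ (fun e z =>
  good [set z' | sup_close e (bcoord z.1) (bcoord z'.1) /\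
    `|set_val z.2 - set_val z'.2 : R| < e])).
have /[swap]/[apply] : forall z : Y * I, setT z ->
    \forall z' \near z & e \near (0 : R)^'+,
      good [set z'' | sup_close e (bcoord z'.1) (bcoord z''.1) /\
        `|set_val z'.2 - set_val z''.2 : R| < e].
  move=> [p t] _; have [A [[B C] [/= Bp Ct] BCA] good_A] := good_nbhs (p, t).
  have [eB /= eB0 eBP] := near_close Bp.
  have [eC /= eC0 eCP] := near_close_unit_interval Ct.
  (* A centre within [e / 2] of [(p, t)] and a radius below [e / 2] stay within [e]; halving the
     minimum puts [e] strictly below both bounds. *)
  pose e := Num.min eB eC / 2.
  have e0 : 0 < e by rewrite divr_gt0// lt_min eB0.
  have e2 : e + e = Num.min eB eC by rewrite /e -splitr.
  have eBC : e < Num.min eB eC by rewrite -e2 ltrDl.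
  exists ([set z' : Y * I | sup_close (e / 2) (bcoord p) (bcoord z'.1) /\
      `|set_val t - set_val z'.2 : R| < e / 2], [set e' : R | e' < e / 2]).
    split=> /=.
      exists ([set q | sup_close (e / 2) (bcoord p) (bcoord q)],
        [set u | `|set_val t - set_val u : R| < e / 2]).
        split=> /=; first by apply: nbhs_sup_close; rewrite divr_gt0.
        have /cvgrPdist_lt/(_ (e / 2)) := @set_val_continuous _ _ t.
        by apply; rewrite divr_gt0.
      by move=> [q u].
    by apply: nbhs_right_lt; rewrite divr_gt0.
  move=> [[p' t'] e'] /= [[pp' tt'] e'e];
    apply: good_sub good_A => -[p'' t''] /=.
  move=> [pp'' tt'']; apply: BCA; split=> /=.
    apply: (eBP e) => //=.
      rewrite sub0r normrN gtr0_norm//; apply: lt_le_trans eBC _.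
      by rewrite ge_min lexx.
    move=> v; rewrite (splitr e); apply: (sup_close_trans pp') => u.
    exact: lt_trans (pp'' u) e'e.
  apply: (eCP e) => //=.
    rewrite sub0r normrN gtr0_norm//; apply: lt_le_trans eBC _.
    by rewrite ge_min lexx orbT.
  rewrite (splitr e) -[X in `|X|](subrKA (set_val t')).
  by apply: le_lt_trans (ler_normD _ _) _; apply: ltrD => //;
    exact: lt_trans e'e.
move=> [e /= e0 eP]; exists (e / 2); first by rewrite divr_gt0.
move=> p t; apply: (eP (e / 2) _ _ (p, t)) => //=; last by rewrite divr_gt0.
by rewrite sub0r normrN gtr0_norm ?divr_gt0// ltr_pdivrMr// ltr_pMr// ltr1n.
Qed.
End LebesgueNumber.

(** * Equivariant simplicial approximation of the sections *)

Section TCtoSC.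
Context (R : realType) (d : Order.disp_t) (n : nat) (K : ocomplex d).
Hypothesis n_gt0 : (0 < n)%N.
Variable a : sym_approximations R n K.

Local Notation M := (cpow n K).
Local Notation X := (realization R K).
Local Notation Y := (realization R M).

Lemma cpermK (g : 'S_n) : cancel (cperm K g) (cperm K g^-1%g).
Proof. exact: ppermK. Qed.

Lemma cpermKV (g : 'S_n) : cancel (cperm K g^-1%g) (cperm K g).
Proof. by have := cpermK g^-1%g; rewrite invgK. Qed.

Lemma project_geom (p : Y) j :
  geom (affine_ext (fun v : M => tnth v j : K) (bcoord p)).
Proof.
have p_geom := bcoord_geom p; have [_ _ [s sM ps]] := p_geom.
exact: affine_ext_geom p_geom ps (cpow_projection j sM).
Qed.

Definition project (p : Y) : {ptws 'I_n -> X} :=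
  fun j => SigSub (mem_set (project_geom p j)).

Lemma project_continuous : continuous project.
Proof.
move=> p; apply: (@ptws_cvg 'I_n X (project @ p) (project p)
  (fmap_filter project (nbhs_filter p))) => j.
apply: (@realization_cvg _ _ _ _ (nbhs p) (project^~ j) _ (nbhs_filter p)) => v.
by apply: continuous_sum => u _; exact: bcoord_continuous.
Qed.

Lemma project_perm (g : 'S_n) (p p' : Y) :
  (forall w, bcoord p' (cperm K g w) = bcoord p w) ->
  project p' = xperm g (project p).
Proof.
move=> pp'; apply/funext => j; apply: val_inj => /=.
apply: (@affine_ext_bij _ _ _ (cperm K g)) => //.
  by exists (cperm K g^-1%g); [exact: cpermK|exact: cpermKV].
by move=> v _; exact: tnth_pperm.
Qed.

Lemma shift_ex (g : 'S_n) (p : Y) :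
  exists p' : Y, forall w, bcoord p' w = bcoord p (cperm K g w).
Proof.
have p'_geom := geom_comp (cpermK g) (cpermKV g) (bcoord_geom p).
by exists (SigSub (mem_set p'_geom)).
Qed.

Variable k : nat.
Variables (U : 'I_k -> set {ptws 'I_n -> X}).
Variables (s : 'I_k -> {ptws 'I_n -> X} -> star_maps R n X).
Hypothesis U_cover : \bigcup_i U i = setT.
Hypothesis U_open : forall i, open (U i).
Hypothesis U_inv : forall i (g : 'S_n), xperm g @` U i = U i.
Hypothesis s_cont : forall i, {within U i, continuous (s i)}.
Hypothesis s_equiv : forall i (g : 'S_n) x, U i x -> forall t j,
  set_val (s i (xperm g x)) (spt t j) = set_val (s i x) (spt t (g j)).
Hypothesis s_end : forall i x, U i x ->
  forall j, set_val (s i x) (spt (ui1 R) j) = x j.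

Let U_perm i (g : 'S_n) x : U i x -> U i (xperm g x).
Proof. by move=> Ux; rewrite -(U_inv i g); exists x. Qed.

Definition path_at i j (p : Y) t : X := set_val (s i (project p)) (spt t j).

Lemma cover_number : exists2 e : R, 0 < e & forall p : Y, exists i,
  forall q : Y, sup_close e (bcoord p) (bcoord q) -> U i (project q).
Proof.
have [|[p t]|e e0 eP] := @lebesgue_number R d M (fun A =>
    exists i, A `<=` [set z | U i (project z.1)]).
- by move=> A B AB [i BU]; exists i; exact: subset_trans AB BU.
- have [i _ Ui] : (\bigcup_i U i) (project p) by rewrite U_cover.
  exists [set z : Y * unit_interval R | U i (project z.1)]; last by exists i.
  have : nbhs (project p) (U i) by apply: open_nbhs_nbhs; split.
  move=> /project_continuous Up; exists ([set q | U i (project q)], setT) => //.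
    by split=> //=; exact: filterT.
  by move=> [q u] [].
exists e => // p; have [i iP] := eP p (ui0 R); exists i => q pq.
apply: (iP (q, ui0 R)); split=> //=; by rewrite subrr normr0.
Qed.

(* The sets [inner e i] shrink the cover by the sets [U i]; the estimates of
   [path_number] are uniform on them. *)
Definition inner (e : R) i (p : Y) : Prop :=
  forall q : Y, sup_close e (bcoord p) (bcoord q) -> U i (project q).

Lemma inner_U e i p : 0 < e -> inner e i p -> U i (project p).
Proof. by move=> e0; apply => v; rewrite subrr normr0. Qed.

Lemma inner_perm e i (g : 'S_n) (p p' : Y) :
  (forall w, bcoord p' (cperm K g w) = bcoord p w) ->
  inner e i p -> inner e i p'.
Proof.
move=> pp' p_in q' pq'; have [q qP] := shift_ex g q'.
rewrite (@project_perm g q q') => [|w]; last by rewrite qP.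
by apply/U_perm/p_in => w; rewrite qP -pp'; exact: pq'.
Qed.

(** Continuity of the paths is known only over [U i], which need not be compact. Near a point
    outside [U i] the estimate holds vacuously: no [q] within [e] of it satisfies [inner e i]. *)
Lemma path_number e : 0 < e -> exists2 e' : R, 0 < e' &
  forall i j (p : Y) (t : unit_interval R), exists w,
    forall (q : Y) (u : unit_interval R), inner e i q ->
    sup_close e' (bcoord p) (bcoord q) -> `|set_val t - set_val u : R| < e' ->
    0 < bcoord (path_at i j q u) w.
Proof.
move=> e0.
have [|[p t]|e' e'0 e'P] := @lebesgue_number R d M (fun A => forall i j,
    exists w, forall z, A z -> inner e i z.1 ->
      0 < bcoord (path_at i j z.1 z.2) w).
- by move=> A B AB Bw i j; have [w wP] := Bw i j; exists w => z /AB; exact: wP.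
- have local (ij : 'I_k * 'I_n) : exists A : set (Y * unit_interval R),
      nbhs (p, t) A /\ exists w, forall z, A z -> inner e ij.1 z.1 ->
        0 < bcoord (path_at ij.1 ij.2 z.1 z.2) w.
    case: ij => i j /=; have [Up|nUp] := pselect (U i (project p)).
      have [w w0] := geom_neq0 (bcoord_geom (path_at i j p t)).
      have w_gt0 : 0 < bcoord (path_at i j p t) w.
        by have [w_ge0 _ _] := bcoord_geom (path_at i j p t);
          rewrite lt_neqAle eq_sym w0 w_ge0.
      exists [set z | 0 < bcoord (path_at i j z.1 z.2) w]; split;
        last by exists w.
      have s_at : {for project p, continuous (s i)}.
        have := s_cont (i := i); rewrite continuous_open_subspace//.
        by move=> /(_ (project p)); apply; rewrite inE.
      have path_cont : {for (p, t), continuous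
          (fun z : Y * unit_interval R => path_at i j z.1 z.2)}.
        apply: (@continuous_comp _ _ _
          (fun z : Y * unit_interval R => (project z.1, z.2))
          (fun z => set_val (s i z.1) (spt z.2 j)) (p, t)).
          apply: continuous_pair; last exact: cvg_snd.
          apply: (@continuous_comp _ _ _ fst project (p, t));
            first exact: cvg_fst.
          exact: project_continuous.
        exact: star_maps_eval.
      have bcoord_cont : {for (p, t), continuous
          (fun z : Y * unit_interval R => bcoord (path_at i j z.1 z.2) w)}.
        apply: (@continuous_comp _ _ _
          (fun z : Y * unit_interval R => path_at i j z.1 z.2) (fun x =>
            bcoord x w)) => //.
        exact: bcoord_continuous.
      exact: (cvgr_gt _ bcoord_cont _ w_gt0).
    exists [set z | sup_close e (bcoord z.1) (bcoord p)]; split.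
      exists ([set q : Y | sup_close e (bcoord p) (bcoord q)], setT).
        by split; [exact: nbhs_sup_close|exact: filterT].
      by move=> [q u] [/= /sup_closeC pq _].
    have [w _] := geom_neq0 (bcoord_geom (path_at i j p t)).
    by exists w => z zp z_in; case: nUp; exact: z_in.
  have [A AP] := choice local.
  exists [set z | forall ij, A ij z].
    by apply: (filter_forall (nbhs_filter (p, t))) => ij; have [] := AP ij.
  move=> i j; have [_ [w wP]] := AP (i, j); exists w => z Az.
  exact: (wP z (Az (i, j))).
exists e' => // i j p t; have [w wP] := e'P p t i j.
by exists w => q u q_in pq tu; exact: (wP (q, u)).
Qed.

Section Construction.
Variables (e e' : R) (r c : nat).
Hypotheses (e_gt0 : 0 < e) (c_gt0 : (0 < c)%N).
Hypothesis cover_e : forall p : Y, exists i,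
  forall q : Y, sup_close e (bcoord p) (bcoord q) -> U i (project q).
Hypothesis path_e' : forall i j (p : Y) (t : unit_interval R), exists w,
  forall (q : Y) (u : unit_interval R), inner (e / 2) i q ->
    sup_close e' (bcoord p) (bcoord q) -> `|set_val t - set_val u : R| < e' ->
    0 < bcoord (path_at i j q u) w.
Hypothesis shrink_e : shrink R M ^+ r < e / 2.
Hypothesis shrink_e' : shrink R M ^+ r < e'.
Hypothesis c_e' : c%:R^-1 < e'.

Local Notation sd := (sdc r M).
Local Notation act := (fun g : 'S_n => sdc_map (cperm K g) r).

Definition place_point (x : sd -> R) (gx : geom x) : Y :=
  SigSub (mem_set (place_geom gx)).

Definition inner_simp i : {set {set sd}} :=
  [set z in simp sd | `[< forall x (gx : geom x), support_in z x ->
     inner (e / 2) i (place_point gx) >]]%SET.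

Lemma inner_simpP i (z : {set sd}) : z \in inner_simp i <->
  z \in simp sd /\ forall x (gx : geom x), support_in z x ->
    inner (e / 2) i (place_point gx).
Proof.
rewrite finset.in_set; split=> [/andP[zM /asboolP]//|[zM z_in]].
by rewrite zM; exact/asboolP.
Qed.

Lemma inner_simp_subcomplex i : subcomplex (inner_simp i).
Proof.
split; first by apply/fintype.subsetP => z /inner_simpP[].
move=> z z' /inner_simpP[zM z_in] /[dup] z'z /fintype.subsetP sub z'0.
apply/inner_simpP; split; first exact: simpS zM z'z z'0.
by move=> x gx xz'; apply: z_in => v /xz'/sub.
Qed.

Lemma act_bij (g : 'S_n) : cancel (act g) (act g^-1%g) /\ cancel (act g^-1%g)
  (act g).
Proof. by split; apply: sdc_mapK; [exact: cpermK|exact: cpermKV]. Qed.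

Lemma place_point_act (g : 'S_n) x x' (gx : geom x) (gx' : geom x') :
  (forall v, x' (act g v) = x v) ->
  forall w, bcoord (place_point gx') (cperm K g w) = bcoord (place_point gx) w.
Proof. by move=> xx' w; exact: place_bij (cpermK g) (cpermKV g) xx'. Qed.

Lemma inner_simp_act i (g : 'S_n) (z : {set sd}) :
  z \in inner_simp i -> act g @: z \in inner_simp i.
Proof.
have [gK gVK] := act_bij g.
move=> /inner_simpP[zM z_in]; apply/inner_simpP; split;
  first exact: (sfunP (act g)).
move=> x' gx' x'z; have gx : geom (x' \o act g).
  by apply: (@geom_comp _ _ sd (act g) (act g^-1%g)).
apply: (@inner_perm _ _ g (place_point gx)); first exact: place_point_act.
apply: z_in => v /= /x'z; by rewrite mem_imset//; exact: can_inj gK.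
Qed.

Lemma inner_simp_cover : (\bigcup_i inner_simp i)%SET = simp sd.
Proof.
apply/setP => z; apply/bigcupP/idP => [[i _ /inner_simpP[]//]|zM].
have /set0Pn[v vz] := simp_neq0 zM.
pose gv := @unit_mass_geom R d sd v; have [i iP] := cover_e (place_point gv).
exists i => //; apply/inner_simpP; split=> // x gx xz q xq; apply: iP.
(* One half of [e] is spent on the size of a simplex, the other on the radius in [inner]. *)
rewrite (splitr e); apply: sup_close_trans xq.
apply: place_close gv gx zM _ xz shrink_e => u.
by rewrite /unit_mass pnatr_eq0 eqb0 negbK => /eqP->.
Qed.

(** The star condition of simplicial approximation: coordinate [w] of the path is positive over the
    open star of [v] in [inner_simp i]. The window of times from [(l - 1) / c] to [l / c] makes the
    stages [l] and [l + 1] share the time [l / c]; for [l = 0] it is reduced to time 0. *)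
Definition value_set i l j (v : sd) : set K := [set w |
  forall x (gx : geom x) (z : {set sd}), z \in inner_simp i -> support_in z x ->
    x v != 0 -> forall t : unit_interval R,
      l%:R - 1 <= c%:R * set_val t <= l%:R ->
    0 < bcoord (path_at i j (place_point gx) t) w].

Definition step_map i l j (v : sd) : K :=
  xget (tnth (sdc_comp a v) j) (value_set i l j v).

Lemma step_time l : (l <= c)%N ->
  exists t : unit_interval R, set_val t = l%:R / c%:R.
Proof.
move=> lc; have t01 : [set t : R | 0 <= t <= 1] (l%:R / c%:R).
  by rewrite /= divr_ge0//= ler_pdivrMr ?ltr0n// mul1r ler_nat.
by exists (SigSub (mem_set t01)).
Qed.

(** The open star of [v] is within [e'] of [v], and the window, of width [1 / c], is within [e'] of
    [l / c]; one [w] from [path_e'] thus serves for all of them. *)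
Lemma value_set_ex i l j v : (l <= c)%N -> [set v]%SET \in inner_simp i ->
  exists w, value_set i l j v w.
Proof.
move=> lc vL; have [t0 t0E] := step_time lc.
pose gv := @unit_mass_geom R d sd v.
have [w wP] := path_e' i j (place_point gv) t0.
exists w => x gx z /inner_simpP[zM z_in] xz xv t /andP[lt tl].
apply: wP; first exact: z_in.
  apply: (place_close gv gx zM _ xz shrink_e') => u.
  by rewrite /unit_mass pnatr_eq0 eqb0 negbK => /eqP->; exact: xz.
apply: le_lt_trans c_e'; have c0 : 0 < c%:R :> R by rewrite ltr0n.
rewrite t0E (_ : _ - _ = (l%:R - c%:R * set_val t) / c%:R); last first.
  by field; rewrite gt_eqF.
rewrite ger0_norm; last by rewrite divr_ge0// ?subr_ge0// ltW.
by rewrite -[leRHS]mul1r ler_pM2r ?invr_gt0// lerBlDr addrC -lerBlDr.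
Qed.

Lemma step_mapP i l j v : (l <= c)%N -> [set v]%SET \in inner_simp i ->
  value_set i l j v (step_map i l j v).
Proof. by move=> lc vL; apply: xgetPex; exact: value_set_ex. Qed.

Lemma value_set_act_sub i l j (g : 'S_n) v :
  value_set i l j (act g v) `<=` value_set i l (g j) v.
Proof.
have [gK gVK] := act_bij g.
move=> w wP x gx z zL xz xv t lt.
have gx' : geom (x \o act g^-1%g) by apply: (@geom_comp _ _ sd _ (act g)).
have x'x u : (x \o act g^-1%g) (act g u) = x u by rewrite /= gK.
have /inner_simpP[_ z_in] := zL.
rewrite (_ : path_at i (g j) (place_point gx) t = path_at i j (place_point gx')
  t).
  apply: (wP _ gx' (act g @: z)%SET) => //; last by rewrite x'x.
    exact: inner_simp_act.
  by move=> u /= /xz uz; apply/imsetP; exists (act g^-1%g u).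
rewrite /path_at (project_perm (place_point_act gx gx' x'x)) s_equiv//.
by apply: (inner_U _ (z_in x gx xz)); rewrite divr_gt0.
Qed.

Lemma value_set_act i l j (g : 'S_n) v :
  value_set i l j (act g v) = value_set i l (g j) v.
Proof.
apply/seteqP; split; first exact: value_set_act_sub.
have [gK _] := act_bij g.
have := @value_set_act_sub i l (g j) g^-1%g (act g v).
by rewrite gK permK.
Qed.

Lemma eq_xget (T : choiceType) (x y : T) (A : set T) :
  (exists z, A z) -> xget x A = xget y A.
Proof.
by move=> A_ex; rewrite /xget; case: pselect => // -[]; have [z Az] := A_ex;
  exists z; exact/asboolP.
Qed.

Lemma step_map_act i l j (g : 'S_n) v : (l <= c)%N ->
  [set v]%SET \in inner_simp i ->
  step_map i l j (act g v) = step_map i l (g j) v.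
Proof.
move=> lc vL; rewrite /step_map value_set_act; apply: eq_xget.
exact: value_set_ex.
Qed.

(** At the barycentre of [z] every vertex of [z] has positive weight, so the path is there at a
    point whose support contains all values of [f] and [f']. *)
Lemma path_common_simp i j (z : {set sd}) (f f' : sd -> K) t :
  z \in inner_simp i ->
  (forall x (gx : geom x) v, support_in z x -> v \in z -> x v != 0 ->
     0 < bcoord (path_at i j (place_point gx) t) (f v) /\
     0 < bcoord (path_at i j (place_point gx) t) (f' v)) ->
  (f @: z :|: f' @: z)%SET \in simp K.
Proof.
move=> /inner_simpP[zM _] ff'; have /set0Pn[v0 v0z] := simp_neq0 zM.
pose w (v : sd) : R := (v \in z)%:R.
have w_neq0 v : (w v != 0) = (v \in z) by rewrite /w pnatr_eq0 eqb0 negbK.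
have w_ge0 v : 0 <= w v by exact: ler0n.
have w_ex : exists v, w v != 0 by exists v0; rewrite w_neq0.
have wz : support_in z w by move=> v; rewrite w_neq0.
have gw : @geom R d sd (normalize w) by apply: normalize_geom => //; exists z.
have nwz : support_in z (normalize w) by move=> v /normalize_neq0/wz.
have nw_neq0 v : v \in z -> normalize w v != 0.
  move=> vz; rewrite mulf_neq0 ?w_neq0// invr_eq0 gt_eqF//.
  exact: sumr_gt0_neq0.
have [_ _ [y yK py]] := bcoord_geom (path_at i j (place_point gw) t).
apply: (simp_subset (x := f v0) yK).
  by rewrite inE; apply/orP; left; exact: imset_f.
apply/fintype.subsetP => u /setUP[] /imsetP[v vz ->]; apply: py;
  rewrite gt_eqF//;
  by have [] := ff' _ gw v nwz vz (nw_neq0 v vz).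
Qed.

Lemma step_map_simp i j l l' (z : {set sd}) :
  (l <= c)%N -> (l' <= c)%N -> l' = l \/ l' = l.+1 -> z \in inner_simp i ->
  (step_map i l j @: z :|: step_map i l' j @: z)%SET \in simp K.
Proof.
move=> lc l'c ll' zL; have [t tE] := step_time lc.
have ct : c%:R * set_val t = l%:R :> R.
  by rewrite tE mulrCA mulfV ?mulr1// pnatr_eq0 -lt0n.
apply: (path_common_simp (t := t) zL) => x gx v xz vz xv.
have vL := subcomplex_vertex (inner_simp_subcomplex i) zL vz.
split; [apply: (step_mapP j lc vL gx zL xz xv)|apply: (step_mapP j l'c vL gx zL
  xz xv)];
  rewrite ct.
  by rewrite lexx andbT lerBlDr lerDl.
case: ll' => ->; first by rewrite lexx andbT lerBlDr lerDl.
by rewrite -natr1 addrK lexx lerDl ler01.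
Qed.

Lemma construction_SC_cover : SC_cover a r k.
Proof.
exists inner_simp; split; first exact: inner_simp_cover.
move=> i; have subL := inner_simp_subcomplex i;
  have vertexL := subcomplex_vertex subL.
split=> //.
  move=> g; have [gK gVK] := act_bij g.
  apply/setP => z; apply/imsetP/idP => [[z' z'L ->]|zL].
    exact: inner_simp_act.
  exists (act g^-1%g @: z)%SET; first exact: inner_simp_act.
  by rewrite -imset_comp (eq_imset _ (g := id)) ?imset_id// => v /=;
    rewrite gVK.
pose j0 := Ordinal n_gt0.
have simp_step l j : (l <= c)%N ->
  simplicial (inner_simp i) (simp K) (step_map i l j).
  move=> lc z zL; have := step_map_simp j lc lc (or_introl erefl) zL.
  by rewrite finset.setUid.
(* The window of stage 0 contains only time 0, where all legs of the star meet, so the set is the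
   same for all [j]. *)
have value0 j v : value_set i 0 j v = value_set i 0 j0 v.
  have sub j1 j2 : value_set i 0 j1 v `<=` value_set i 0 j2 v.
    move=> w wP x gx z zL xz xv t tl.
    have t0 : t = ui0 R.
      apply: val_inj => /=; apply/eqP;
        have /andP[t_ge0 _] : 0 <= (set_val t : R) <= 1.
        exact: (set_valP t).
      rewrite eq_le t_ge0 andbT; case/andP: tl => _.
      by rewrite pmulr_rle0// ltr0n.
    have := wP x gx z zL xz xv t tl; rewrite /path_at t0.
    by rewrite /spt (@wedge_liftE _ _ (fun _ : 'I_n =>
      ui0 R) j2 (ui0 R) j1 (ui0 R)).
  by apply/seteqP; split; exact: sub.
have eq0 j v : [set v]%SET \in inner_simp i ->
  step_map i 0 j v = step_map i 0 j0 v.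
  by move=> vL; rewrite /step_map value0; apply: eq_xget; exact: value_set_ex.
have contiguous l : (l <= c)%N ->
    sym_contiguous (fun g => act g) (inner_simp i) (simp K) (step_map i l).
  elim: l => [_|l IH lc]; last first.
    apply: (sym_contiguous_step vertexL (IH (ltnW lc))).
    - by move=> j; exact: simp_step.
    - by move=> g j v vL; exact: step_map_act.
    - by move=> j z zL; apply: step_map_simp => //; [exact: ltnW|right].
  have cst : sym_contiguous (fun g => act g) (inner_simp i) (simp K)
      (fun _ => step_map i 0 j0).
    apply: sym_contiguous_cst; first exact: simp_step.
    by move=> g v vL; rewrite step_map_act// eq0.
  apply: (sym_contiguous_step vertexL cst).
  - by move=> j; exact: simp_step.
  - by move=> g j v vL; exact: step_map_act.
  - move=> j z zL; rewrite (_ : step_map i 0 j @: z = step_map i 0 j0 @: z)%SET.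
      by rewrite finset.setUid; exact: simp_step.
    by apply: eq_in_imset => v vz; apply: eq0; exact: vertexL vz.
(* A last link leads to the projections: at time 1 the path is at the projected point, where the
   values of [sdc_comp a] have positive coordinates by [vpos_comp]. *)
apply: (sym_contiguous_step vertexL (contiguous c (leqnn c))).
- by move=> j z /inner_simpP[zM _]; exact: approx_simplicial.
- by move=> g j v _; rewrite sdc_comp_equivariant tnth_pperm.
move=> j z zL; apply: (path_common_simp (j := j) (t :=
  ui1 R) zL) => x gx v xz vz xv.
split.
  apply: (step_mapP j (leqnn c) (vertexL _ _ zL vz) gx zL xz xv).
  by rewrite /= mulr1 lexx andbT lerBlDr lerDl.
have /inner_simpP[_ z_in] := zL.
rewrite /path_at s_end; last by apply: (inner_U _ (z_in x gx xz));
  rewrite divr_gt0.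
rewrite [ltRHS](_ : _ = affine_ext (fun v : M => tnth v j : K) (place x)
  (tnth (sdc_comp a v) j))// /affine_ext (bigD1 (sdc_comp a v))//=.
have [place_ge0 _ _] := place_geom gx.
rewrite ltr_wpDr ?sumr_ge0// /place (bigD1 v)//=.
have [x_ge0 _ _] := gx.
rewrite ltr_wpDr//.
  by apply: sumr_ge0 => u _; rewrite mulr_ge0// vpos_ge0.
rewrite mulr_gt0//; first by rewrite lt_neqAle eq_sym xv x_ge0.
apply: vpos_comp => l u.
exact: (@approximates_id_in R d (sdc l M) (a l) u (@approx_id R d n K a l)).
Qed.
End Construction.

Lemma sections_SC_cover : exists r, SC_cover a r k.
Proof.
have [e e0 cover_e] := cover_number.
have e20 : 0 < e / 2 by rewrite divr_gt0.
have [e' e'0 path_e'] := path_number e20.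
have e''0 : 0 < Num.min (e / 2) e' by rewrite lt_min e20.
have [r] := shrink_small M e''0; rewrite lt_min => /andP[re re'].
have [c] := ltr_add_invr e'0; rewrite add0r => c_e'.
exists r; apply: (@construction_SC_cover e e' r c.+1) => //.
Qed.
End TCtoSC.

Lemma TC_cover_SC_cover (R : realType) (d : Order.disp_t) (n : nat)
    (K : ocomplex d) (a : sym_approximations R n K) k : (0 < n)%N ->
  TC_cover R n (realization R K) k -> exists r, SC_cover a r k.
Proof.
move=> n_gt0 [U [s [U_cover UP]]];
  apply: (@sections_SC_cover R d n K n_gt0 a k U s).
- exact: U_cover.
- by move=> i; have [] := UP i.
- by move=> i; have [] := UP i.
- by move=> i; have [] := UP i.
- by move=> i g x Ux; have [_ _ _ + _] := UP i; apply.
- by move=> i x Ux; have [_ _ _ _ +] := UP i; apply.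
Qed.

(** * The three complexities *)

(** Sections are precomposed with the map of fences that sends [(m+1)_j] to [m_j] and fixes the
    rest; a relation involving [m + 1] collapses to an equality. *)
Lemma CC_cover_leqS (d : Order.disp_t) (n : nat) (P : finPOrderType d) r m k :
  CC_cover n P r m k -> CC_cover n P r m.+1 k.
Proof.
move=> [Q [s [Q_cover QP]]].
pose trunc (a : fences n m.+1) : fences n m :=
  if a is Some (j, t) then fpt (inord (minn t.+1 m)) j else None.
have truncE (t : 'I_m.+2) j : trunc (fpt t j) = fpt (inord (minn t m)) j.
  rewrite {1}/fpt; case: unliftP => [t' ->//|->] /=.
  by rewrite min0n (_ : inord 0 = ord0) ?fpt0//; apply: val_inj;
    rewrite /= inordK.
have trunc_homo : {homo trunc : a b / (a <= b)%O}.
  move=> a b; rewrite [(_ <= _)%O]fence_leE => /predU1P[->//|].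
  move=> /existsP[j] /existsP[u] /existsP[t] /and4P[/eqP-> /eqP-> uo ut].
  rewrite !truncE; have [um|mu] := leqP u m; have [tm|mt] := leqP t m.
  - by apply: fpt_le; rewrite !inordK.
  - by rewrite (_ : (u : nat) = m)//; case/orP: ut => /eqP ut; lia.
  - by rewrite (_ : (t : nat) = m)//; case/orP: ut => /eqP ut; lia.
  - exact: lexx.
have ex_trunc i x : exists e : pexp (fences n m.+1) P,
    forall a, val e a = val (s i x) (trunc a).
  by apply: pexp_of_homo => a b /trunc_homo; exact: pexp_homo.
have [s' s'E] := choice (fun ix : 'I_k * _ => ex_trunc ix.1 ix.2).
exists Q, (fun i x => s' (i, x)); split=> // i.
have [oQ Q_inv s_cont s_equiv s_end] := QP i; split=> //.
- apply/within_downset_continuous => // x y Qx yx; apply/forallP => a.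
  rewrite !s'E; have s_homo := (within_downset_continuous (s i) oQ).1 s_cont.
  exact: (forallP (s_homo _ _ Qx yx)).
- by move=> g x Qx t j; rewrite !s'E !truncE; exact: s_equiv.
- move=> x Qx j; rewrite s'E truncE -s_end//; congr (val (s i x) (fpt _ j)).
  by apply: val_inj; rewrite /= inordK (minn_idPr (leqnSn m)).
Qed.

Lemma CC_least (d : Order.disp_t) (n : nat) (P : finPOrderType d) :
  CC n P = least [set k | exists r m, CC_cover n P r m k].
Proof.
rewrite /CC (_ : CCr n P = fun r =>
  least [set k | exists m, CC_cover n P r m k]).
  by rewrite (min_value_least (fun r =>
    [set k | exists m, CC_cover n P r m k])).
apply/funext => r.
by rewrite /CCr (stable_value_least (A := CC_cover n P r))// => m k;
  exact: CC_cover_leqS.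
Qed.

Theorem theoremB (R : realType) (d : Order.disp_t) (P : finPOrderType d)
    (P_connected : connected [set: downset_space P]%classic)
    (n : nat) (n_ge2 : (2 <= n)%N)
    (a : sym_approximations R n (order_complex P)) :
  CC n P = SC a /\ SC a = TC R n (realization R (order_complex P)).
Proof.
have n_gt0 : (0 < n)%N by exact: ltnW.
have SC_least : SC a = least [set k | exists r, SC_cover a r k].
  exact: min_value_least.
have CC_SC k : (exists r m, CC_cover n P r m k) -> exists r, SC_cover a r k.
  by move=> [r [m /(CC_cover_SC_cover n_gt0 a)]]; exists r.
have SC_CC k : (exists r, SC_cover a r k) -> exists r m, CC_cover n P r m k.
  by move=> [r /SC_cover_CC_cover[m]]; exists r.+1, m.
rewrite SC_least CC_least; split; apply: eq_least => k; split.
- exact: CC_SC.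
- exact: SC_CC.
(* The weights live on subsets of the poset [sd^r(P^n)], so the way from SC to TC leads through
   CC. *)
- by move=> /SC_CC[r [m]]; exact: CC_cover_TC_cover.
- exact: TC_cover_SC_cover.
Qed.
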